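(* Let $L=L_0\oplus L_1$ be a Lie superalgebra over a field of characteristic zero, with bracket $(\,,)$ and universal enveloping algebra $U(L)$. The following conditions are equivalent: (1) $U(L)$ is Lie nilpotent; (2) $U(L)$ is bounded Lie Engel; (3) $L_0$ is abelian, $L$ is nilpotent, $(L,L)$ is finite-dimensional, and either $(L_1,L_1)=0$, or $\dim L_1\leq 1$ and $(L_0,L_1)=0$.
   Context: A Lie superalgebra over a field $\mathbb{F}$ of characteristic different from $2$ is a $\mathbb{Z}_2$-graded vector space $L=L_0\oplus L_1$ with a bilinear bracket $(\,,)$ satisfying $(L_i,L_j)\subseteq L_{i+j}$, $(a,b)=-(-1)^{|a||b|}(b,a)$ and $(a,(b,c))=((a,b),c)+(-1)^{|a||b|}(b,(a,c))$ for homogeneous $a,b,c$, where $|a|\in\mathbb{Z}_2$ is the degree of $a$. Here $L$ may be infinite-dimensional. For subspaces $H,K\subseteq L$, $(H,K)$ denotes the linear span of all $(h,k)$, $h\in H$, $k\in K$. ''$L_0$ is abelian'' means $(L_0,L_0)=0$. $L$ is nilpotent if $\gamma_n(L)=0$ for some $n$, where $\gamma_1(L)=L$ and $\gamma_{n+1}(L)=(\gamma_n(L),L)$. The enveloping algebra $U(L)$ is the quotient of the tensor algebra of $L$ by the ideal generated by all $a\otimes b-(-1)^{|a||b|}b\otimes a-(a,b)$, with $a,b\in L$ homogeneous. For an associative algebra $R$, put $[a,b]=ab-ba$ (the ordinary commutator, not a supercommutator) and $[a_1,\ldots,a_{k+1}]=[[a_1,\ldots,a_k],a_{k+1}]$.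 $R$ is Lie nilpotent if for some $n$ it satisfies $[a_1,\ldots,a_n]=0$ for all $a_1,\ldots,a_n\in R$. $R$ is bounded Lie Engel (i.e. satisfies the Engel condition) if there is an integer $n\ge 1$ such that $[x,\underbrace{y,\ldots,y}_{n}]=0$ for all $x,y\in R$. *)

(* Defs.v *)
From HB Require Import structures.
From mathcomp Require Import all_boot all_algebra.
From mathcomp Require Import boolp classical_sets.
From mathcomp Require Import monalg.

Set Implicit Arguments.
Unset Strict Implicit.
Unset Printing Implicit Defensive.

Import GRing.Theory Quotient.

Local Open Scope classical_set_scope.
Local Open Scope quotient_scope.
Local Open Scope ring_scope.

Section Subspaces.
Variables (F : fieldType) (V : lmodType F).

Definition is_subspace (W : set V) : Prop :=
  W 0 /\ forall (a : F) x y, W x -> W y -> W (a *: x + y).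

Definition lspan (S : set V) : set V := smallest is_subspace S.

Definition lfree n (e : 'I_n -> V) : Prop :=
  forall c : 'I_n -> F, \sum_i c i *: e i = 0 -> forall i, c i = 0.

Definition has_dim (W : set V) (n : nat) : Prop :=
  exists2 e : 'I_n -> V, lfree e & lspan (range e) = W.

Definition finite_dim (W : set V) : Prop := exists n, has_dim W n.

Definition dim_le (W : set V) (m : nat) : Prop :=
  exists2 n, (n <= m)%N & has_dim W n.

End Subspaces.

(* The degrees, elements of Z/2, are booleans: [false] is 0, [true] is 1,
   addition is [addb] and multiplication is [andb].  [homog i] is the
   homogeneous component L_i. *)
HB.mixin Record Lmodule_isLieSuperalgebra (F : fieldType) L
    of GRing.Lmodule F L := {
  homog : bool -> set L;
  brk : L -> L -> L;
  homog_subspace : forall i, @is_subspace F L (homog i);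
  homog_sum : forall x : L,
    exists x0 x1, [/\ homog false x0, homog true x1 & x = x0 + x1];
  homog_direct : forall x : L, homog false x -> homog true x -> x = 0;
  brk_linearl : forall (k : F) (a b c : L),
    brk (k *: a + b) c = k *: brk a c + brk b c;
  brk_linearr : forall (k : F) (a b c : L),
    brk a (k *: b + c) = k *: brk a b + brk a c;
  brk_homog : forall i j a b,
    homog i a -> homog j b -> homog (i (+) j) (brk a b);
  brk_skew : forall i j a b, homog i a -> homog j b ->
    brk a b = - ((-1) ^+ (i && j) *: brk b a);
  brk_jacobi : forall i j k a b c, homog i a -> homog j b -> homog k c ->
    brk a (brk b c) = brk (brk a b) c + (-1) ^+ (i && j) *: brk b (brk a c)
}.

#[short(type="lieSuperalgType")]
HB.structure Definition LieSuperalgebra (F : fieldType) :=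
  {L of GRing.Lmodule F L & Lmodule_isLieSuperalgebra F L}.

Section LieSuperalgebraNotions.
Variables (F : fieldType) (L : lieSuperalgType F).

Definition brk_span (H K : set L) : set L :=
  lspan [set brk h k | h in H & k in K].

(* [lower_central n] is the term usually written gamma_(n+1): it starts with
   gamma_1(L) = L. *)
Fixpoint lower_central (n : nat) : set L :=
  if n is n'.+1 then brk_span (lower_central n') [set: L] else [set: L].

Definition nilpotent_super : Prop := exists n, lower_central n = [set 0].

End LieSuperalgebraNotions.

Arguments nilpotent_super {F} L.

(* The quotient carries a proof that the ideal is proper because [algType]
   requires 1 != 0. *)
Section AlgebraQuotient.
Variables (F : fieldType) (A : algType F).

Definition is_ideal (I : set A) : Prop :=
  [/\ is_subspace I,
      forall a x, I x -> I (a * x) &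
      forall a x, I x -> I (x * a)].

Definition ideal_gen (S : set A) : set A := smallest is_ideal S.

Lemma ideal_gen_ideal S : is_ideal (ideal_gen S).
Proof.
split; first split.
- by move=> I [[[I0 _] _ _] _].
- move=> a x y Ix Iy I IS; have [[[_ Iax] _ _] _] := IS.
  by apply: Iax; [exact: Ix I IS | exact: Iy I IS].
- by move=> a x Ix I IS; have [[_ Il _] _] := IS; exact: Il (Ix I IS).
- by move=> a x Ix I IS; have [[_ _ Ir] _] := IS; exact: Ir (Ix I IS).
Qed.

Definition ideal_pred (S : set A) : {pred A} := fun x => `[< ideal_gen S x >].

Lemma ideal_predP S x : reflect (ideal_gen S x) (x \in ideal_pred S).
Proof. exact: asboolP. Qed.

Lemma ideal_pred_zmod_closed S : zmod_closed (ideal_pred S).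
Proof.
have [[I0 Iax] _ _] := ideal_gen_ideal S.
split; first exact/ideal_predP.
move=> x y /ideal_predP Ix /ideal_predP Iy; apply/ideal_predP.
by rewrite addrC -scaleN1r; apply: Iax.
Qed.

HB.instance Definition _ S :=
  GRing.isZmodClosed.Build A (ideal_pred S) (ideal_pred_zmod_closed S).

Lemma ideal_predMl S a x : x \in ideal_pred S -> a * x \in ideal_pred S.
Proof.
have [_ Il _] := ideal_gen_ideal S.
move=> /ideal_predP Ix; apply/ideal_predP; exact: Il.
Qed.

Lemma ideal_predMr S a x : x \in ideal_pred S -> x * a \in ideal_pred S.
Proof.
have [_ _ Ir] := ideal_gen_ideal S.
move=> /ideal_predP Ix; apply/ideal_predP; exact: Ir.
Qed.

Lemma ideal_predZ S c x : x \in ideal_pred S -> c *: x \in ideal_pred S.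
Proof. by move=> Ix; rewrite -mulr_algl ideal_predMl. Qed.

Definition proper_gen (S : set A) : Prop := ~ ideal_gen S 1.

Definition alg_quot (S : set A) (properS : proper_gen S) : Type :=
  {quot (ideal_pred S)}.

Section Structure.
Variables (S : set A) (properS : proper_gen S).
Notation Q := (alg_quot properS).

HB.instance Definition _ := GRing.Zmodule.on Q.
HB.instance Definition _ := EqQuotient.on Q.
HB.instance Definition _ :=
  @isZmodQuotient.Build A (equiv (ideal_pred S)) 0 -%R +%R Q
    (lock _) (@pi_opp _ _) (@pi_add _ _).

Definition aq_one : Q := lift_cst Q 1.
Definition aq_mul := lift_op2 Q *%R.
Definition aq_scale (c : F) := lift_op1 Q ( *:%R c).

Canonical pi_aq_one_morph := PiConst aq_one.

Lemma pi_aq_mul : {morph \pi_Q : x y / x * y >-> aq_mul x y}.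
Proof.
move=> x y; unlock aq_mul; apply/eqP; rewrite piE equivE.
rewrite -[_ * _](addrNK (x * repr (\pi_Q y))) -mulrBr -addrA -mulrBl rpredD //.
  by apply: ideal_predMl; rewrite idealrBE reprK.
by apply: ideal_predMr; rewrite idealrBE reprK.
Qed.
Canonical pi_aq_mul_morph := PiMorph2 pi_aq_mul.

Lemma pi_aq_scale c : {morph \pi_Q : x / c *: x >-> aq_scale c x}.
Proof.
move=> x; unlock aq_scale; apply/eqP; rewrite piE equivE -scalerBr.
by apply: ideal_predZ; rewrite idealrBE reprK.
Qed.
Canonical pi_aq_scale_morph c := PiMorph1 (pi_aq_scale c).

Lemma aq_mulA : associative aq_mul.
Proof. by move=> x y z; rewrite -[x]reprK -[y]reprK -[z]reprK !piE mulrA. Qed.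

Lemma aq_mul1 : left_id aq_one aq_mul.
Proof. by move=> x; rewrite -[x]reprK !piE mul1r. Qed.

Lemma aq_mulr1 : right_id aq_one aq_mul.
Proof. by move=> x; rewrite -[x]reprK !piE mulr1. Qed.

Lemma aq_mulDl : left_distributive aq_mul +%R.
Proof.
by move=> x y z; rewrite -[x]reprK -[y]reprK -[z]reprK !piE mulrDl.
Qed.

Lemma aq_mulDr : right_distributive aq_mul +%R.
Proof.
by move=> x y z; rewrite -[x]reprK -[y]reprK -[z]reprK !piE mulrDr.
Qed.

Lemma aq_one_neq0 : aq_one != 0.
Proof.
by rewrite piE equivE subr0; apply/negP => /ideal_predP; apply: properS.
Qed.

HB.instance Definition _ := GRing.Zmodule_isNzRing.Build Q
  aq_mulA aq_mul1 aq_mulr1 aq_mulDl aq_mulDr aq_one_neq0.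

Lemma aq_scaleA a b x : aq_scale a (aq_scale b x) = aq_scale (a * b) x.
Proof. by rewrite -[x]reprK !piE scalerA. Qed.

Lemma aq_scale1 : left_id 1 aq_scale.
Proof. by move=> x; rewrite -[x]reprK !piE scale1r. Qed.

Lemma aq_scaleDr : right_distributive aq_scale +%R.
Proof. by move=> a x y; rewrite -[x]reprK -[y]reprK !piE scalerDr. Qed.

Lemma aq_scaleDl x : {morph aq_scale^~ x : a b / a + b}.
Proof. by move=> a b; rewrite -[x]reprK !piE scalerDl. Qed.

HB.instance Definition _ := GRing.Zmodule_isLmodule.Build F Q
  aq_scaleA aq_scale1 aq_scaleDr aq_scaleDl.

Lemma aq_scaleAl (c : F) (x y : Q) : c *: (x * y) = (c *: x) * y.
Proof.
change (aq_scale c (aq_mul x y) = aq_mul (aq_scale c x) y).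
by rewrite -[x]reprK -[y]reprK !piE scalerAl.
Qed.

HB.instance Definition _ := GRing.Lmodule_isLalgebra.Build F Q aq_scaleAl.

Lemma aq_scaleAr (c : F) (x y : Q) : c *: (x * y) = x * (c *: y).
Proof.
change (aq_scale c (aq_mul x y) = aq_mul x (aq_scale c y)).
by rewrite -[x]reprK -[y]reprK !piE scalerAr.
Qed.

HB.instance Definition _ := GRing.Lalgebra_isAlgebra.Build F Q aq_scaleAr.

Definition aq_proj (x : A) : Q := \pi_Q x.

End Structure.

(* Generators killed by a character of A generate a proper ideal, and the
   character descends to the quotient. *)
Section Augmentation.
Variables (S : set A) (eps : {rmorphism A -> F}).
Hypothesis epsS : forall x, S x -> eps x = 0.

Lemma ideal_gen_ker x : ideal_gen S x -> eps x = 0.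
Proof.
apply: (_ : ideal_gen S `<=` [set y | eps y = 0]).
apply: smallest_sub => //; split; first split.
- exact: rmorph0.
- by move=> a y z /= ey ez; rewrite rmorphD -mulr_algl rmorphM ey ez mulr0 addr0.
- by move=> a y /= ey; rewrite rmorphM ey mulr0.
- by move=> a y /= ey; rewrite rmorphM ey mul0r.
Qed.

Lemma proper_of_aug : proper_gen S.
Proof. by move=> /ideal_gen_ker/eqP; rewrite rmorph1 oner_eq0. Qed.

Variable properS : proper_gen S.
Notation Q := (alg_quot properS).

Definition aq_aug (x : Q) : F := eps (repr x).

Lemma aq_aug_proj x : aq_aug (aq_proj properS x) = eps x.
Proof.
apply/eqP; rewrite -subr_eq0 -rmorphB; apply/eqP/ideal_gen_ker/ideal_predP.
by rewrite idealrBE reprK.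
Qed.

Lemma aq_aug_zmod : zmod_morphism aq_aug.
Proof.
move=> x y; rewrite -{1}[x]reprK -{1}[y]reprK -[RHS]rmorphB -aq_aug_proj.
by rewrite /aq_proj !piE.
Qed.

Lemma aq_aug_monoid : monoid_morphism aq_aug.
Proof.
split; first by rewrite -(rmorph1 eps) -aq_aug_proj /aq_proj !piE.
move=> x y; rewrite -{1}[x]reprK -{1}[y]reprK -[RHS]rmorphM -aq_aug_proj.
by rewrite /aq_proj !piE.
Qed.

End Augmentation.
End AlgebraQuotient.

(* Free associative unital algebra on the set X, that is, the algebra of the
   monoid of words in X. *)
Section FreeAlgebra.
Variables (F : fieldType) (X : choiceType).

Definition free_alg : Type := {malg F[{fmonom X}]}.

HB.instance Definition _ := GRing.Lalgebra.on free_alg.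

Lemma free_alg_scaleAr (c : F) (x y : free_alg) : c *: (x * y) = x * (c *: y).
Proof.
apply/malgP => k; rewrite mcoeffZ mcoeffMl.
rewrite (@mcoeffMlw _ _ (msupp x) (msupp y)) ?msuppZ_le //.
rewrite mulr_sumr; apply: eq_bigr => k1 _; rewrite mulr_sumr.
by apply: eq_bigr => k2 _; rewrite mcoeffZ mulrnAr mulrCA.
Qed.

HB.instance Definition _ :=
  GRing.Lalgebra_isAlgebra.Build F free_alg free_alg_scaleAr.

Definition free_gen (x : X) : free_alg := << fmu x >>.

Definition free_aug (p : free_alg) : F := p@_(mone : {fmonom X}).

Lemma free_aug_zmod : zmod_morphism free_aug.
Proof. exact: mcoeffB. Qed.

Lemma free_aug_monoid : monoid_morphism free_aug.
Proof.
by have [eM e1] := @mcoeff1g_is_multiplicative {fmonom X} F; split.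
Qed.

HB.instance Definition _ :=
  GRing.isZmodMorphism.Build free_alg F free_aug free_aug_zmod.
HB.instance Definition _ :=
  GRing.isMonoidMorphism.Build free_alg F free_aug free_aug_monoid.

Lemma free_aug_gen x : free_aug (free_gen x) = 0.
Proof.
rewrite /free_aug /free_gen mcoeffU1.
by case: eqP => // /(congr1 (@fmonom_val X)); rewrite /fmu fmE fm1.
Qed.

End FreeAlgebra.

Section TensorAlgebra.
Variables (F : fieldType) (V : lmodType F).

(* Modulo these relations the free algebra on the set V becomes the tensor
   algebra of the vector space V. *)
Definition tensor_rel : set (free_alg F V) :=
  [set p | exists (a : F) (x y : V),
     p = free_gen F (a *: x + y) - (a *: free_gen F x + free_gen F y)].

Lemma tensor_rel_aug p : tensor_rel p -> free_aug p = 0.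
Proof.
move=> [a [x [y ->]]]; rewrite rmorphB rmorphD -mulr_algl rmorphM /=.
by rewrite !free_aug_gen mulr0 addr0 subr0.
Qed.

Definition tensor_rel_proper : proper_gen tensor_rel :=
  proper_of_aug tensor_rel_aug.

Definition tensor_alg : Type := alg_quot tensor_rel_proper.

HB.instance Definition _ := GRing.Algebra.on tensor_alg.

Definition tensor_in (x : V) : tensor_alg :=
  aq_proj tensor_rel_proper (free_gen F x).

Definition tensor_aug (t : tensor_alg) : F :=
  aq_aug (@free_aug F V) (properS := tensor_rel_proper) t.

Lemma tensor_aug_zmod : zmod_morphism tensor_aug.
Proof. exact (@aq_aug_zmod _ _ _ _ tensor_rel_aug tensor_rel_proper). Qed.

Lemma tensor_aug_monoid : monoid_morphism tensor_aug.
Proof. exact (@aq_aug_monoid _ _ _ _ tensor_rel_aug tensor_rel_proper). Qed.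

HB.instance Definition _ :=
  GRing.isZmodMorphism.Build tensor_alg F tensor_aug tensor_aug_zmod.
HB.instance Definition _ :=
  GRing.isMonoidMorphism.Build tensor_alg F tensor_aug tensor_aug_monoid.

Lemma tensor_aug_in x : tensor_aug (tensor_in x) = 0.
Proof.
by rewrite /tensor_aug (aq_aug_proj tensor_rel_aug) /= free_aug_gen.
Qed.

End TensorAlgebra.

Section EnvelopingAlgebra.
Variables (F : fieldType) (L : lieSuperalgType F).

Local Notation t := (@tensor_in F L).

Definition env_rel : set (tensor_alg L) :=
  [set p | exists (i j : bool) (a b : L), [/\ homog i a, homog j b &
     p = t a * t b - (-1) ^+ (i && j) *: (t b * t a) - t (brk a b)]].

Lemma env_rel_aug p : env_rel p -> tensor_aug p = 0.
Proof.
move=> [i [j [a [b [_ _ ->]]]]]; rewrite !rmorphB -mulr_algl !rmorphM /=.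
by rewrite !tensor_aug_in !mulr0 !subr0.
Qed.

Definition env_rel_proper : proper_gen env_rel := proper_of_aug env_rel_aug.

Definition env_alg : Type := alg_quot env_rel_proper.

HB.instance Definition _ := GRing.Algebra.on env_alg.

End EnvelopingAlgebra.

Arguments env_alg {F} L.

Section LieConditions.
Variable R : pzRingType.

(* The ordinary commutator: also for enveloping algebras, no sign. *)
Definition comm_br (a b : R) : R := a * b - b * a.

(* Left-normed commutators of weight n.+1. *)
Definition lie_nilpotent : Prop :=
  exists n, forall (a : R) (s : n.-tuple R), foldl comm_br a s = 0.

Definition bounded_lie_engel : Prop :=
  exists2 n, (1 <= n)%N &
    forall x y : R, iter n (fun z => comm_br z y) x = 0.

End LieConditions.

(* Main.v *)
From HB Require Import structures.
Require Import Defs.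
From mathcomp Require Import all_boot all_algebra.
From mathcomp Require Import boolp classical_sets.
From mathcomp Require Import monalg perm ring zify.

(** A family of forms on words in [L] that is multilinear and satisfies
[f (u a b v) = (-1)^(|a||b|) f (u b a v) + f (u (a,b) v)] is the same thing as
a linear functional on [U(L)].  In characteristic zero every supersymmetric
form of degree [m] extends to such a family, vanishing on shorter words: in
each degree the relations ask for a common fixed point of affine involutions
that satisfy the relations of the symmetric group, and averaging gives one.
This replaces the Poincare-Birkhoff-Witt theorem, without choosing a basis.

If [U(L)] is [n]-Engel and [D = [-, a]] is nilpotent with [D y = c] and
[D c = 0], then [D^n (y^n) = n! c^n] vanishes, while nonzero elements of [L_0]
are not nilpotent in [U(L)]; hence [L_0] is abelian.  If [w = (x,x)] is nonzero
for an odd [x], then [D = [-, x]] satisfies [D^2 z = 2 w z] for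
[z = w y - (x,y) x], which forces every odd [y] to be a multiple of [x].
Otherwise the odd elements anticommute, [D^n (y_1 ... y_n) = n! D y_1 ... D y_n]
when [D^2 y_i = 0], and products of linearly independent odd elements do not
vanish.  This bounds the rank of each [ad a] on the layers of the filtration
[L_1, (L_0,L_1), (L_0,(L_0,L_1)), ...]; the commutators of [engel_zeta] bound
the orbits [(L_0,y)], and an element of maximal rank bounds the whole layer.

Conversely, when [(L_1,L_1) = 0] the weights [k] of the layers define a
filtration of [U(L)] that a supercommutator raises by one, hence so does a
double commutator; finite dimension and nilpotency of [(L_0,L_1)] make the
terms of large weight vanish. *)

Set Implicit Arguments.
Unset Strict Implicit.
Unset Printing Implicit Defensive.

Import GRing.Theory.
Local Open Scope classical_set_scope.
Local Open Scope ring_scope.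

(** * Subspaces and linear functionals *)

Section LinearAlgebra.
Variables (F : fieldType) (V : lmodType F).
Implicit Types (S W X : set V) (s : seq V).

Lemma subspace0 W : is_subspace W -> W 0.
Proof. by case. Qed.

Lemma subspace_set0 : is_subspace [set 0 : V].
Proof. by split=> // a x y -> ->; rewrite scaler0 addr0. Qed.

Lemma subspaceZ W a x : is_subspace W -> W x -> W (a *: x).
Proof. by move=> [W0 Wl] Wx; rewrite -[_ *: x]addr0; apply: Wl. Qed.

Lemma subspaceD W x y : is_subspace W -> W x -> W y -> W (x + y).
Proof. by move=> [_ Wl] Wx Wy; rewrite -[x]scale1r; apply: Wl. Qed.

Lemma subspaceN W x : is_subspace W -> W x -> W (- x).
Proof. by move=> sW Wx; rewrite -scaleN1r; apply: subspaceZ. Qed.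

Lemma subspaceB W x y : is_subspace W -> W x -> W y -> W (x - y).
Proof. by move=> sW Wx Wy; apply: subspaceD => //; apply: subspaceN. Qed.

Lemma subspace_sum W (I : Type) (r : seq I) (E : I -> V) :
  is_subspace W -> (forall i, W (E i)) -> W (\sum_(i <- r) E i).
Proof.
move=> sW WE; elim: r => [|i r IH]; first by rewrite big_nil; apply: subspace0.
by rewrite big_cons; apply: subspaceD.
Qed.

Lemma lspan_subspace S : is_subspace (lspan S).
Proof.
split=> [X [[X0 _] _] //|a x y Sx Sy X XS]; have [[_ Xl] _] := XS.
by apply: Xl; [exact: Sx | exact: Sy].
Qed.

Lemma sub_lspan S x : S x -> lspan S x.
Proof. by move=> Sx X [_]; apply. Qed.

Lemma lspan_min S W : is_subspace W -> S `<=` W -> lspan S `<=` W.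
Proof. exact: smallest_sub. Qed.

Lemma lspan_eq0 S : (forall x, S x -> x = 0) -> lspan S = [set 0].
Proof.
move=> S0; apply/seteqP; split; last first.
  by move=> _ ->; apply: subspace0; exact: lspan_subspace.
exact: lspan_min subspace_set0 S0.
Qed.

(** For a subspace [W] this is [W] plus the span of a finite list; inclusion in it expresses finite
    dimension modulo [W] without forming a quotient space. *)
Definition mod_span W s : set V := lspan (W `|` [set` s]).

Lemma mod_span_subspace W s : is_subspace (mod_span W s).
Proof. exact: lspan_subspace. Qed.

Lemma mod_spanW W s x : W x -> mod_span W s x.
Proof. by move=> Wx; apply: sub_lspan; left. Qed.

Lemma mod_span_mem W s x : x \in s -> mod_span W s x.
Proof. by move=> sx; apply: sub_lspan; right. Qed.

Lemma mod_span_min W s X : is_subspace X -> W `<=` X -> (forall x, x \in s -> X x) ->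
  mod_span W s `<=` X.
Proof. by move=> sX WX sX'; apply: lspan_min => // x [/WX|/sX']. Qed.

Lemma mod_span_sub W s s' : {subset s <= s'} -> mod_span W s `<=` mod_span W s'.
Proof.
move=> ss; apply: mod_span_min => [|x|x /ss]; first exact: mod_span_subspace.
- exact: mod_spanW.
- exact: mod_span_mem.
Qed.

Lemma mod_spanP W s x : is_subspace W -> mod_span W s x ->
  exists c : 'I_(size s) -> F, W (x - \sum_i c i *: s`_i).
Proof.
move=> sW.
apply: (mod_span_min
  (X := [set x | exists c : 'I_(size s) -> F, W (x - \sum_i c i *: s`_i)])).
- split.
    exists (fun=> 0); rewrite big1 ?subr0 => [|i _]; last by rewrite scale0r.
    exact: subspace0.
  move=> a y z [c Wy] [d Wz]; exists (fun i => a * c i + d i).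
  rewrite (_ : _ - _ = a *: (y - \sum_i c i *: s`_i) + (z - \sum_i d i *: s`_i)).
    by case: sW => _; apply.
  rewrite scalerBr scaler_sumr addrACA -opprD -big_split /=; congr (_ - _).
  by apply: eq_bigr => i _; rewrite scalerDl scalerA.
- move=> y Wy; exists (fun=> 0).
  by rewrite big1 ?subr0 => [|i _]; rewrite ?scale0r.
- move=> y ys; have lt : (index y s < size s)%N by rewrite index_mem.
  exists (fun i => (i == Ordinal lt)%:R).
  rewrite (bigD1 (Ordinal lt)) //= eqxx scale1r nth_index // big1 ?addr0 ?subrr.
    exact: subspace0.
  by move=> i /negbTE ->; rewrite scale0r.
Qed.

(* Zorn's lemma yields a hyperplane through [W] that avoids [w]. *)
Lemma separating_functional W w : is_subspace W -> ~ W w ->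
  exists phi : {scalar V}, phi w = 1 /\ forall x, W x -> phi x = 0.
Proof.
move=> sW Ww.
(* [W] is joined to [X] inside the predicate so that the empty chain, whose union is empty,
   satisfies it too. *)
pose P X := is_subspace (W `|` X) /\ ~ (W `|` X) w.
have [|A [[sA Aw] Amax]] := @Zorn_bigcup V P.
  move=> C CP Ctot; split; last first.
    case=> [//|[X CX Xw]]; by case: (CP X CX) => _; apply; right.
  have common x y : (W `|` \bigcup_(X in C) X) x -> (W `|` \bigcup_(X in C) X) y ->
      (W x /\ W y) \/ exists2 X, C X & (W `|` X) x /\ (W `|` X) y.
    move=> [Wx|[X CX Xx]] [Wy|[Y CY Yy]].
    - by left.
    - by right; exists Y => //; split; [left|right].
    - by right; exists X => //; split; [right|left].
    - have [XY|YX] := Ctot X Y CX CY.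
        by right; exists Y => //; split; right => //; apply: XY.
      by right; exists X => //; split; right => //; apply: YX.
  split; first by left; apply: subspace0.
  move=> a x y /common h /h {h}[[Wx Wy]|[X CX [Xx Xy]]].
    by left; case: sW => _; apply.
  have [[_ /(_ a x y Xx Xy)[Wl|Xl]] _] := CP X CX; first by left.
  by right; exists X.
pose M := W `|` A.
(* If [x] is outside [M], maximality puts [w] into [M + F x]. The coefficient of [x] is nonzero
   since [w] is not in [M], and inverting it expresses [x] through [w] modulo [M]. *)
have decomp x : exists c, M (x - c *: w).
  have [Mx|Mx] := pselect (M x); first by exists 0; rewrite scale0r subr0.
  pose N := [set y | exists c, M (y - c *: x)].
  have sN : is_subspace N.
    split; first by exists 0; rewrite scale0r subr0; apply: subspace0.
    move=> a y z [c My] [d Mz]; exists (a * c + d).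
    rewrite (_ : _ - _ = a *: (y - c *: x) + (z - d *: x)).
      by case: sA => _; apply.
    by rewrite scalerBr addrACA -opprD scalerDl scalerA.
  have MN : M `<=` N by move=> y My; exists 0; rewrite scale0r subr0.
  have Nx : N x by exists 1; rewrite scale1r subrr; apply: subspace0.
  have WN : W `|` N = N.
    by apply/seteqP; split=> [y [Wy|//]|y]; [apply: MN; left|right].
  have [Nw|Nw] := pselect (N w); last first.
    case: (Amax N); last by split; rewrite WN.
    split; first by move=> y Ay; apply: MN; right.
    by move=> NA; apply: Mx; right; apply: NA.
  have [c Mwc] := Nw; exists c^-1.
  have c0 : c != 0.
    by apply/eqP => c0; apply: Aw; move: Mwc; rewrite c0 scale0r subr0.
  rewrite (_ : _ - _ = - c^-1 *: (w - c *: x)); first exact: subspaceZ.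
  by rewrite scaleNr scalerBr scalerA mulVf // scale1r opprB.
have uniq x c d : M (x - c *: w) -> M (x - d *: w) -> c = d.
  move=> Mc Md; apply/eqP; rewrite -subr_eq0; apply/negPn/negP => cd; apply: Aw.
  rewrite -[w]scale1r -(mulVf cd) -scalerA; apply: subspaceZ => //.
  rewrite (_ : _ *: w = (x - d *: w) - (x - c *: w)); first exact: subspaceB.
  by rewrite scalerBl opprB [RHS]addrC addrA subrK.
pose f x : F := projT1 (cid (decomp x)).
have fP x : M (x - f x *: w) by rewrite /f; case: cid.
have flin : scalar f.
  move=> a x y; apply: (@uniq (a *: x + y)) => //.
  rewrite (_ : _ - _ = a *: (x - f x *: w) + (y - f y *: w)).
    by case: sA => _ sAl; apply: sAl; apply: fP.
  by rewrite scalerBr addrACA -opprD scalerDl scalerA.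
pose phi : {scalar V} := HB.pack f (GRing.isLinear.Build F V F *%R f flin).
exists phi; split=> [|x Wx].
  by apply: (@uniq w) => //; rewrite scale1r subrr; apply: subspace0.
by apply: (@uniq x) => //; rewrite scale0r subr0; left.
Qed.

Lemma lspan_range n (e : 'I_n -> V) x :
  lspan (range e) x -> exists c : 'I_n -> F, x = \sum_i c i *: e i.
Proof.
apply: (lspan_min (W := [set x | exists c : 'I_n -> F, x = \sum_i c i *: e i])).
  split; first by exists (fun=> 0); rewrite big1 // => i _; rewrite scale0r.
  move=> a _ _ [c ->] [d ->]; exists (fun i => a * c i + d i).
  rewrite scaler_sumr -big_split /=.
  by apply: eq_bigr => i _; rewrite scalerDl scalerA.
move=> _ [j _ <-]; exists (fun i => (i == j)%:R).
rewrite (bigD1 j) //= eqxx scale1r big1 ?addr0 // => i /negbTE ->.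
by rewrite scale0r.
Qed.

(** A relation between the rows of the coordinate matrix is a relation between the [e i], so the
    left kernel is zero and the rank [n] is at most the number of columns. *)
Lemma lfree_size n (e : 'I_n -> V) s :
  lfree e -> (forall i, mod_span [set 0] s (e i)) -> (n <= size s)%N.
Proof.
move=> free es.
have coord i : exists c : 'I_(size s) -> F, e i = \sum_j c j *: s`_j.
  by have [c /eqP] := mod_spanP subspace_set0 (es i); rewrite subr_eq0 => /eqP; exists c.
pose C := \matrix_(i < n, j < size s) projT1 (cid (coord i)) j.
have eE i : e i = \sum_j C i j *: s`_j.
  rewrite [LHS](projT2 (cid (coord i))); apply: eq_bigr => j _.
  by rewrite mxE.
have rC : \rank C = n; last by rewrite -rC rank_leq_col.
apply/eqP; rewrite eqn_leq rank_leq_row /= -subn_eq0 -mxrank_ker.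
rewrite mxrank_eq0; apply/eqP/matrixP => k i; rewrite [RHS]mxE.
apply: (free (fun i => kermx C k i)).
under eq_bigr => j _ do rewrite eE scaler_sumr.
rewrite exchange_big /= big1 // => j _.
under eq_bigr => l _ do rewrite scalerA.
rewrite -scaler_suml.
have := congr1 (fun M : 'M_(_, _) => M k j) (mulmx_ker C).
by rewrite !mxE => ->; rewrite scale0r.
Qed.

(** Free families in [W] have bounded length by [lfree_size]. One of maximal length spans [W],
    because a vector outside of its span would extend it. *)
Lemma finite_dim_mod_span W s :
  is_subspace W -> W `<=` mod_span [set 0] s -> finite_dim W.
Proof.
move=> sW Ws.
pose P n := `[< exists e : 'I_n -> V, lfree e /\ forall i, W (e i) >].
have P0 : exists n, P n by exists 0%N; apply/asboolP; exists (fun=> 0); split=> [? ? []|[]].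
have Pmax n : P n -> (n <= size s)%N.
  by move=> /asboolP[e [free eW]]; apply: (lfree_size free) => i; apply: Ws.
have [n /asboolP[e [free eW]] nmax] := ex_maxnP P0 Pmax.
exists n, e => //; apply/seteqP; split; first by apply: lspan_min => // _ [i _ <-].
move=> x Wx; have [//|xe] := pselect (lspan (range e) x).
suff /nmax : P n.+1 by rewrite ltnn.
apply/asboolP; exists (fun i => oapp e x (unlift ord_max i)); split; last first.
  by move=> i; case: (unlift _ i) => [j|]; [apply: eW|].
move=> c; rewrite (bigD1_ord ord_max) //= unlift_none /=.
under eq_bigr => i _ do rewrite liftK /=.
move=> sum0.
have c0 : c ord_max = 0.
  apply/eqP/negPn/negP => c0; apply: xe.
  rewrite -[x]scale1r -(mulVf c0) -scalerA; apply: (@subspaceZ (lspan (range e))).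
    exact: lspan_subspace.
  rewrite (_ : _ *: x = - \sum_(i < n) c (lift ord_max i) *: e i); last first.
    by apply/eqP; rewrite -addr_eq0; apply/eqP.
  apply: (@subspaceN (lspan (range e))); first exact: lspan_subspace.
  apply: (@subspace_sum (lspan (range e))) => [|i]; first exact: lspan_subspace.
  by apply: (@subspaceZ (lspan (range e))); [exact: lspan_subspace | apply: sub_lspan; exists i].
move: sum0; rewrite c0 scale0r add0r => /free cl i.
by case: (unliftP ord_max i) => [j|] ->.
Qed.

End LinearAlgebra.

Section CharacteristicZero.
Variables (F : fieldType) (charF0 : [pchar F] =i pred0).

Lemma natr_neq0 n : n.+1%:R != 0 :> F.
Proof. by have /pcharf0P -> := charF0. Qed.

Lemma twice_eq0 (V : lmodType F) (u : V) : u + u = 0 -> u = 0.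
Proof.
move=> uu; rewrite -[u]scale1r -(mulVf (natr_neq0 1)) -scalerA.
by rewrite scaler_nat [u *+ _]mulr2n uu scaler0.
Qed.

End CharacteristicZero.

(** * Linear functionals on enveloping algebras *)

(** One form for each word length, packed into a single function; by [tensor_functional] this yields
    a linear functional on the tensor algebra. *)
Definition multilinear (F : fieldType) (V : lmodType F) (f : seq V -> F) : Prop :=
  forall u v a x y,
    f (u ++ (a *: x + y) :: v) = a * f (u ++ x :: v) + f (u ++ y :: v).

Section Words.
Variables (F : fieldType) (A : algType F).

Definition word (I : Type) (gen : I -> A) (w : seq I) : A := \prod_(x <- w) gen x.

(** The words span [A], phrased as an induction principle so that [elim/] can use it. *)
Definition linearly_generates (I : Type) (gen : I -> A) : Prop :=
  forall P : A -> Prop, P 0 -> (forall a x y, P x -> P y -> P (a *: x + y)) ->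
  (forall w, P (word gen w)) -> forall x, P x.

Lemma word_cat_cons (I : Type) (gen : I -> A) u z v :
  word gen (u ++ z :: v) = word gen u * gen z * word gen v.
Proof. by rewrite /word big_cat big_cons /= mulrA. Qed.

Lemma word_cat_cons2 (I : Type) (gen : I -> A) u x y v :
  word gen (u ++ x :: y :: v) = word gen u * (gen x * gen y) * word gen v.
Proof. by rewrite /word big_cat !big_cons /= !mulrA. Qed.

Lemma functional_linear_rel (V : lmodType F) (gen : V -> A) (g : {scalar A})
    (f : seq V -> F) a x y u v :
  multilinear f -> (forall w, g (word gen w) = f w) ->
  g (word gen u * (gen (a *: x + y) - (a *: gen x + gen y)) * word gen v) = 0.
Proof.
move=> fl gf; rewrite mulrBr mulrDr mulrBl mulrDl raddfB raddfD /=.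
by rewrite -scalerAr -scalerAl scalarZ -!word_cat_cons !gf fl subrr.
Qed.

Lemma functional_env_rel (V : lmodType F) (gen : V -> A) (g : {scalar A})
    (f : seq V -> F) c x y z u v :
  f (u ++ x :: y :: v) = c * f (u ++ y :: x :: v) + f (u ++ z :: v) ->
  (forall w, g (word gen w) = f w) ->
  g (word gen u * (gen x * gen y - c *: (gen y * gen x) - gen z) * word gen v) = 0.
Proof.
move=> fE gf; rewrite 2!mulrBr 2!mulrBl !raddfB /= -scalerAr -scalerAl scalarZ.
rewrite -!word_cat_cons2 -!word_cat_cons !gf fE.
by rewrite [X in X - _ - _]addrC addrK subrr.
Qed.

End Words.

Section QuotientProjection.
Variables (F : fieldType) (A : algType F) (S : set A) (properS : proper_gen S).
Local Notation proj := (aq_proj properS).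

Lemma aq_projD : {morph proj : x y / x + y}.
Proof. by move=> x y; rewrite /aq_proj raddfD. Qed.

Lemma aq_projB : {morph proj : x y / x - y}.
Proof. by move=> x y; rewrite /aq_proj raddfB. Qed.

Lemma aq_projM : {morph proj : x y / x * y}.
Proof. exact: pi_aq_mul. Qed.

Lemma aq_proj1 : proj 1 = 1.
Proof. by rewrite /aq_proj !piE. Qed.

Lemma aq_projZ a : {morph proj : x / a *: x}.
Proof. exact: pi_aq_scale. Qed.

Lemma aq_proj0 : proj 0 = 0.
Proof. by rewrite -(subrr 0) aq_projB subrr. Qed.

Lemma aq_projP u : exists x, u = proj x.
Proof. by exists (repr u); rewrite /aq_proj reprK. Qed.

Lemma aq_proj_eq0 x : S x -> proj x = 0.
Proof.
move=> Sx; rewrite -aq_proj0; apply/eqP; rewrite /aq_proj piE.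
rewrite Quotient.equivE subr0; apply/ideal_predP => I [_]; exact.
Qed.

(** The elements [y] with [g (u * y * v) = 0] for all [u] and [v] form an ideal. By linearity in [u]
    and [v], that it contains [S] need only be checked on words. *)
Lemma functional_ideal (I : Type) (gen : I -> A) (g : {scalar A}) x :
  linearly_generates gen ->
  (forall u s v, S s -> g (word gen u * s * word gen v) = 0) ->
  ideal_gen S x -> forall u v, g (u * x * v) = 0.
Proof.
move=> genA gwS.
apply: (smallest_sub (X := [set y | forall u v, g (u * y * v) = 0])); last first.
  move=> s Ss u v; elim/genA: u => [|a u1 u2 IH1 IH2|u].
  - by rewrite !mul0r raddf0.
  - by rewrite !mulrDl -!scalerAl linearP /= IH1 IH2 mulr0 addr0.
  elim/genA: v => [|a v1 v2 IH1 IH2|v].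
  - by rewrite mulr0 raddf0.
  - by rewrite mulrDr -scalerAr linearP /= IH1 IH2 mulr0 addr0.
  exact: gwS.
split; first split.
- by move=> u v; rewrite mulr0 mul0r raddf0.
- move=> a x1 x2 I1 I2 u v.
  by rewrite mulrDr mulrDl -scalerAr -scalerAl linearP /= I1 I2 mulr0 addr0.
- by move=> a x1 I1 u v; rewrite mulrA I1.
- by move=> a x1 I1 u v; rewrite mulrA -[_ * a * v]mulrA I1.
Qed.

Lemma alg_quot_functional (I : Type) (gen : I -> A) (g : {scalar A}) :
  linearly_generates gen ->
  (forall u s v, S s -> g (word gen u * s * word gen v) = 0) ->
  exists h : {scalar alg_quot properS}, forall x, h (proj x) = g x.
Proof.
move=> genA gwS.
have projg x y : proj x = proj y -> g x = g y.
  move=> /eqP; rewrite /aq_proj piE Quotient.equivE => /ideal_predP Ixy.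
  have := functional_ideal genA gwS Ixy 1 1.
  by rewrite mul1r mulr1 raddfB => /eqP; rewrite subr_eq0 => /eqP.
pose h (u : alg_quot properS) := g (repr u).
have hP x : h (proj x) = g x by apply: projg; rewrite {1}/aq_proj reprK.
have hlin : scalar h.
  move=> a u v; have [x ->] := aq_projP u; have [y ->] := aq_projP v.
  by rewrite -aq_projZ -aq_projD !hP linearP.
pose h' : {scalar _} := HB.pack h (GRing.isLinear.Build F _ F *%R h hlin).
by exists h'.
Qed.

End QuotientProjection.

Section FreeAlgebra.
Variables (F : fieldType) (X : choiceType).

Lemma free_wordE w : word (@free_gen F X) w = << FMonom w >>.
Proof.
elim: w => [|x w IH]; first by rewrite /word big_nil -fmoneE.
rewrite /word big_cons -/(word _ w) IH /free_gen.
rewrite [LHS](@fgmulUU {fmonom X} F) mulr1.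
by congr (<< _ >>); rewrite fmuE [LHS]fmmulE.
Qed.

Lemma free_alg_ind : linearly_generates (@free_gen F X).
Proof.
move=> P P0 Pl Pw p; rewrite (monalgE p).
elim: (finmap.enum_fset _) => [|k r IH]; first by rewrite big_nil.
rewrite big_cons (_ : << p@_k *g k >> = p@_k *: word (@free_gen F X) k); first exact: Pl.
rewrite free_wordE; apply/malgP => k'.
by rewrite mcoeffZ !mcoeffU fmK mulrnAr mulr1.
Qed.

(** Words are a basis of the free algebra, so values on them are arbitrary; [mmap] serves as linear
    extension of an [h] that need not be multiplicative. *)
Lemma free_functional (f : seq X -> F) :
  exists g : {scalar free_alg F X}, forall w, g (word (@free_gen F X) w) = f w.
Proof.
pose h : {fmonom X} -> F := fun k => f k.
have glin : scalar (mmap (idfun : F -> F) h : free_alg F X -> F).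
  move=> a x y; rewrite raddfD /=; congr (_ + _).
  rewrite (mmapEw (msuppZ_le _ _)) mmapE mulr_sumr.
  by apply: eq_bigr => k _; rewrite mcoeffZ mulrA.
pose g : {scalar free_alg F X} := HB.pack (mmap idfun h : free_alg F X -> F)
   (GRing.isLinear.Build F (free_alg F X) F *%R _ glin).
exists g => w; by rewrite free_wordE [LHS](@mmapU {fmonom X} F F idfun h) mul1r.
Qed.

End FreeAlgebra.

Section TensorAlgebra.
Variables (F : fieldType) (V : lmodType F).

Lemma tensor_in_linear a (x y : V) :
  tensor_in (a *: x + y) = a *: tensor_in x + tensor_in y.
Proof.
apply/eqP; rewrite -subr_eq0; apply/eqP.
rewrite -aq_projZ -aq_projD -aq_projB; apply: aq_proj_eq0.
by exists a, x, y.
Qed.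

Lemma tensor_wordE w :
  word (@tensor_in F V) w = aq_proj (@tensor_rel_proper F V) (word (@free_gen F V) w).
Proof.
rewrite /word.
elim: w => [|x w IH]; first by rewrite !big_nil aq_proj1.
by rewrite !big_cons aq_projM -IH.
Qed.

Lemma tensor_alg_ind : linearly_generates (@tensor_in F V).
Proof.
move=> P P0 Pl Pw t; have [p ->] := aq_projP (properS := @tensor_rel_proper F V) t.
elim/free_alg_ind: p => [|a x y Px Py|w].
- by rewrite aq_proj0.
- by rewrite aq_projD aq_projZ; apply: Pl.
- by rewrite -tensor_wordE.
Qed.

Lemma tensor_functional (f : seq V -> F) : multilinear f ->
  exists g : {scalar tensor_alg V}, forall w, g (word (@tensor_in F V) w) = f w.
Proof.
move=> fl; have [g0 g0w] := free_functional f.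
have [|g gP] := alg_quot_functional (@tensor_rel_proper F V) (g := g0)
    (@free_alg_ind F V).
  move=> u _ v [a [x [y ->]]].
  exact: functional_linear_rel fl g0w.
by exists g => w; rewrite tensor_wordE gP g0w.
Qed.

End TensorAlgebra.

Section EnvelopingAlgebra.
Variables (F : fieldType) (L : lieSuperalgType F).

Definition env_in (x : L) : env_alg L :=
  aq_proj (@env_rel_proper F L) (tensor_in x).

Lemma env_in_linear a x y : env_in (a *: x + y) = a *: env_in x + env_in y.
Proof. by rewrite /env_in tensor_in_linear aq_projD aq_projZ. Qed.

Lemma env_in_rel i j a b : homog i a -> homog j b ->
  env_in a * env_in b =
  (-1) ^+ (i && j) *: (env_in b * env_in a) + env_in (brk a b).
Proof.
move=> ha hb; apply/eqP; rewrite -subr_eq0 opprD addrA; apply/eqP.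
rewrite -2!(aq_projM (@env_rel_proper F L)) -aq_projZ -2!aq_projB; apply: aq_proj_eq0.
by exists i, j, a, b.
Qed.

Lemma env_wordE w : word env_in w = aq_proj (@env_rel_proper F L) (word (@tensor_in F L) w).
Proof.
rewrite /word.
elim: w => [|x w IH]; first by rewrite !big_nil aq_proj1.
by rewrite !big_cons aq_projM -IH.
Qed.

Lemma env_alg_ind : linearly_generates env_in.
Proof.
move=> P P0 Pl Pw t; have [p ->] := aq_projP (properS := @env_rel_proper F L) t.
elim/tensor_alg_ind: p => [|a x y Px Py|w].
- by rewrite aq_proj0.
- by rewrite aq_projD aq_projZ; apply: Pl.
- by rewrite -env_wordE.
Qed.

Lemma env_functional (f : seq L -> F) : multilinear f ->
  (forall i j a b u v, homog i a -> homog j b ->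
    f (u ++ a :: b :: v) =
    (-1) ^+ (i && j) * f (u ++ b :: a :: v) + f (u ++ brk a b :: v)) ->
  exists g : {scalar env_alg L}, forall w, g (word env_in w) = f w.
Proof.
move=> fl frel; have [g0 g0w] := tensor_functional fl.
have [|g gP] := alg_quot_functional (@env_rel_proper F L) (g := g0)
    (@tensor_alg_ind F L).
  move=> u _ v [i [j [a [b [ha hb ->]]]]].
  by apply: functional_env_rel g0w; apply: frel.
by exists g => w; rewrite env_wordE gP g0w.
Qed.

End EnvelopingAlgebra.

(** * A Poincare-Birkhoff-Witt theorem in characteristic zero *)

Section OddPart.
Variables (F : fieldType) (L : lieSuperalgType F).
Implicit Types (x y : L).

Lemma odd_part_ex x : exists y, homog true y /\ homog false (x - y).
Proof.
have [x0 [x1 [h0 h1 ->]]] := homog_sum x.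
by exists x1; rewrite addrK.
Qed.

Definition odd_part x : L := projT1 (cid (odd_part_ex x)).

Lemma odd_partP x : homog true (odd_part x).
Proof. by rewrite /odd_part; case: cid => y []. Qed.

Lemma even_partP x : homog false (x - odd_part x).
Proof. by rewrite /odd_part; case: cid => y []. Qed.

Lemma odd_part_unique x y : homog true y -> homog false (x - y) -> odd_part x = y.
Proof.
move=> hy hxy; apply/eqP; rewrite -subr_eq0; apply/eqP/homog_direct; last first.
  by apply: subspaceB (odd_partP x) hy; apply: homog_subspace.
rewrite (_ : _ - _ = (x - y) - (x - odd_part x)).
  by apply: subspaceB hxy (even_partP x); apply: homog_subspace.
by rewrite opprB [RHS]addrC addrA subrK.
Qed.

Lemma odd_part_odd x : homog true x -> odd_part x = x.
Proof.
move=> hx; apply: odd_part_unique => //; rewrite subrr.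
exact: subspace0 (homog_subspace _).
Qed.

Lemma odd_part_even x : homog false x -> odd_part x = 0.
Proof.
move=> hx; apply: odd_part_unique; first exact: subspace0 (homog_subspace _).
by rewrite subr0.
Qed.

Lemma odd_part_linear a x y : odd_part (a *: x + y) = a *: odd_part x + odd_part y.
Proof.
apply: odd_part_unique.
  by have [_] := homog_subspace (s := L) true; apply; apply: odd_partP.
rewrite opprD addrACA -scalerBr.
by have [_] := homog_subspace (s := L) false; apply; apply: even_partP.
Qed.

End OddPart.

Section Multilinear.
Variables (F : fieldType) (L : lieSuperalgType F).
Implicit Types (f g : seq L -> F) (u v w : seq L).

Lemma multilinear_cons f a : multilinear f -> multilinear (fun w => f (a :: w)).
Proof. by move=> fl u v c x y; apply: (fl (a :: u)). Qed.

Lemma multilinear0 f u v : multilinear f -> f (u ++ 0 :: v) = 0.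
Proof.
move=> fl; have := fl u v 1 0 0; rewrite scaler0 addr0 mul1r => /esym/eqP.
by rewrite -subr_eq0 addrK => /eqP.
Qed.

Lemma multilinearD f u v x y : multilinear f ->
  f (u ++ (x + y) :: v) = f (u ++ x :: v) + f (u ++ y :: v).
Proof. by move=> fl; rewrite -{1}[x]scale1r fl mul1r. Qed.

Lemma multilinearZ f u v a x : multilinear f ->
  f (u ++ (a *: x) :: v) = a * f (u ++ x :: v).
Proof. by move=> fl; rewrite -{1}[a *: x]addr0 fl multilinear0 // addr0. Qed.

Lemma multilinearN f u v x : multilinear f ->
  f (u ++ (- x) :: v) = - f (u ++ x :: v).
Proof. by move=> fl; rewrite -scaleN1r multilinearZ // mulN1r. Qed.

Definition homogeneous (x : L) : Prop := exists i, homog i x.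

(** The letters are split one after another into even and odd parts; [u] holds the letters already
    made homogeneous. *)
Lemma multilinear_eq f g w : multilinear f -> multilinear g ->
  (forall w', size w' = size w -> (forall x, x \in w' -> homogeneous x) ->
     f w' = g w') ->
  f w = g w.
Proof.
move=> fl gl; rewrite -[w]cat0s.
have : forall x, x \in [::] -> homogeneous x by [].
elim: w [::] => [|x w IH] u hu fg.
  by apply: fg => // x; rewrite cats0; apply: hu.
have xE : x = (x - odd_part x) + odd_part x by rewrite subrK.
have step y : homogeneous y -> f (u ++ y :: w) = g (u ++ y :: w).
  move=> hy; rewrite -cat_rcons; apply: IH => [z|w' sw].
    by rewrite mem_rcons inE => /orP[/eqP ->|/hu].
  by apply: fg; rewrite sw !size_cat size_rcons addnS.
rewrite xE (multilinearD _ _ _ _ fl) (multilinearD _ _ _ _ gl).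
congr (_ + _); apply: step; last by exists true; apply: odd_partP.
by exists false; apply: even_partP.
Qed.

End Multilinear.

(** * Deformed action of the symmetric group on multilinear forms *)

Section Transpositions.
Variables (F : fieldType) (L : lieSuperalgType F) (K : set L).
Hypothesis oddK : forall x, K x -> homog true x.
Hypothesis brkKl : forall x y, K x -> K (brk x y).
Hypothesis brkKr : forall x y, K y -> K (brk x y).
Implicit Types (f g : seq L -> F) (u v w : seq L).

(** [K] plays the role of an ideal of odd elements. Forms killed by it stand for functionals on the
    enveloping algebra of [L] modulo [K], a quotient that is never formed. *)
Definition vanishes f : Prop := forall u x v, K x -> f (u ++ x :: v) = 0.

(** Subtracting twice the value on the odd parts turns the sign of [f (b :: a :: v)] exactly when
    [a] and [b] are both odd. This writes the factor [(-1)^(|a||b|)] without case distinction,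
    linearly in [a] and in [b]. *)
Fixpoint swap p f w : F :=
  match p, w with
  | 0, a :: b :: v =>
      f (b :: a :: v) - 2 * f (odd_part b :: odd_part a :: v) + f (brk a b :: v)
  | p'.+1, a :: v => swap p' (fun s => f (a :: s)) v
  | _, _ => f w
  end.

(* [trans n p] acts on forms of degree [n] as the transposition of the letters
   [p] and [p.+1], deformed by the bracket, so that a form fixed by it respects
   the relation of the enveloping algebra at the position [p]. *)
Definition trans n p f w : F := if size w == n then swap p f w else f w.

Lemma swap_linear p f g c w :
  swap p (fun s => c * f s + g s) w = c * swap p f w + swap p g w.
Proof.
elim: p f g w => [|p IH] f g [|a w] //=.
case: w => [|b w] //=; ring.
Qed.

Lemma swap_at f u a b v :
  swap (size u) f (u ++ a :: b :: v) =
  f (u ++ b :: a :: v) - 2 * f (u ++ odd_part b :: odd_part a :: v)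
  + f (u ++ brk a b :: v).
Proof. by elim: u f => [|x u IH] f //=; rewrite IH. Qed.

Lemma swap_multilinear p f : multilinear f -> multilinear (swap p f).
Proof.
elim: p f => [|p IH] f fl u v c x y.
  case: u => [|a [|b u]] /=.
  - case: v => [|b v]; first exact: (fl [::]).
    rewrite (fl [:: b]) odd_part_linear (fl [:: odd_part b]) brk_linearl (fl [::]) /=.
    ring.
  - rewrite (fl [::]) odd_part_linear (fl [::]) brk_linearr (fl [::]) /=.
    ring.
  - rewrite (fl [:: b, a & u]) (fl [:: odd_part b, odd_part a & u]) (fl (brk a b :: u)) /=.
    ring.
case: u => [|a u] /=; last exact: (IH _ (multilinear_cons a fl)).
rewrite -swap_linear; congr swap; apply/funext => s; exact: (fl [::]).
Qed.

Lemma swap0 p w : swap p (fun=> 0) w = 0.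
Proof.
elim: p w => [|p IH] [|a w] //=.
by case: w => // b w; rewrite mulr0 subrr addr0.
Qed.

Lemma swap_vanishes p f : vanishes f -> vanishes (swap p f).
Proof.
elim: p f => [|p IH] f fK u x v Kx.
  case: u => [|a [|b u]] /=.
  - case: v => [|b v]; first exact: (fK [::]).
    rewrite (fK [:: b]) // (odd_part_odd (oddK Kx)) (fK [:: odd_part b]) //.
    by rewrite (fK [::]) ?mulr0 ?subrr ?addr0 //; apply: brkKl.
  - rewrite (fK [::]) // (odd_part_odd (oddK Kx)) (fK [::]) //.
    by rewrite (fK [::]) ?mulr0 ?subrr ?addr0 //; apply: brkKr.
  - rewrite (fK [:: b, a & u]) // (fK [:: odd_part b, odd_part a & u]) //.
    by rewrite (fK (brk a b :: u)) // mulr0 subrr addr0.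
case: u => [|a u] /=.
  rewrite (_ : (fun s => f (x :: s)) = fun=> 0) ?swap0 //.
  by apply/funext => s; apply: (fK [::]).
by apply: IH => // u' y v' Ky; apply: (fK (a :: u')).
Qed.

Lemma trans_multilinear n p f : multilinear f -> multilinear (trans n p f).
Proof.
move=> fl u v c x y; rewrite /trans !size_cat /=; case: eqP => _; last exact: fl.
exact: swap_multilinear.
Qed.

Lemma trans_vanishes n p f : vanishes f -> vanishes (trans n p f).
Proof.
move=> fK u x v Kx; rewrite /trans; case: eqP => _; last exact: fK.
exact: swap_vanishes.
Qed.

Lemma trans_neq n p f w : size w != n -> trans n p f w = f w.
Proof. by rewrite /trans => /negbTE ->. Qed.

Lemma trans_at n f i j a b u v : multilinear f -> homog i a -> homog j b ->
  size (u ++ a :: b :: v) = n ->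
  trans n (size u) f (u ++ a :: b :: v) =
  (-1) ^+ (i && j) * f (u ++ b :: a :: v) + f (u ++ brk a b :: v).
Proof.
move=> fl ha hb sw; rewrite /trans sw eqxx swap_at; congr (_ + _).
case: i ha => ha; last first.
  have f0 : f (u ++ odd_part b :: 0 :: v) = 0 by rewrite -cat_rcons multilinear0.
  by rewrite (odd_part_even ha) f0 mulr0 subr0 mul1r.
case: j hb => hb; last first.
  by rewrite (odd_part_even hb) multilinear0 // mulr0 subr0 mul1r.
by rewrite !odd_part_odd // expr1; ring.
Qed.

(** The relations hold up to length [n - 1]. The bracket term of a word of length [n] is shorter, so
    in repairing degree [n] it is already settled. *)
Definition respects n f : Prop := forall i j a b u v,
  homog i a -> homog j b -> (size (u ++ a :: b :: v) < n)%N ->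
  f (u ++ a :: b :: v) =
  (-1) ^+ (i && j) * f (u ++ b :: a :: v) + f (u ++ brk a b :: v).

Definition good n f : Prop := [/\ multilinear f, vanishes f & respects n f].

Lemma trans_good n p f : good n f -> good n (trans n p f).
Proof.
move=> [fl fK fr]; split; [exact: trans_multilinear|exact: trans_vanishes|].
have short w : (size w < n)%N -> trans n p f w = f w.
  by move=> sw; rewrite trans_neq // neq_ltn sw.
move=> i j a b u v ha hb sw; rewrite (short _ sw) (fr i j) //.
have sz : (size (u ++ b :: a :: v) < n)%N by rewrite size_cat -(size_cat u [:: a, b & v]).
rewrite (short _ sz) (short (u ++ _)) // ltnW //.
by move: sz; rewrite !size_cat /= !addnS.
Qed.

Lemma split_at p n w : size w = n -> (p.+1 < n)%N ->
  exists u a b v, w = u ++ a :: b :: v /\ size u = p.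
Proof.
move=> sw pn; case dw: (drop p w) (size_drop p w) => [|a [|b v]] /=; rewrite sw.
- by move/esym/eqP; rewrite subn_eq0 leqNgt ltnW.
- move/esym/eqP; rewrite -addn1 -(eqn_add2r p) subnK ?(ltnW (ltnW pn)) //.
  by rewrite add1n eqn_leq leqNgt pn.
- move=> _; exists (take p w), a, b, v; rewrite -dw cat_take_drop; split=> //.
  by rewrite size_takel // sw ltnW // ltnW.
Qed.

Lemma trans_homog_eq n (f g : seq L -> F) : multilinear f -> multilinear g ->
  (forall w, size w != n -> f w = g w) ->
  (forall w, size w = n -> (forall x, x \in w -> homogeneous x) -> f w = g w) ->
  f = g.
Proof.
move=> fl gl out inn; apply/funext => w.
have [sw|/eqP sw] := eqVneq (size w) n; last exact/out/eqP.
by apply: multilinear_eq => // w' sw'; apply: inn; rewrite sw'.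
Qed.

(** The two bracket terms cancel by skew-symmetry, since the inner transposition does not act on the
    shorter word. *)
Lemma trans_involutive n p f : good n f -> (p.+1 < n)%N ->
  trans n p (trans n p f) = f.
Proof.
move=> [fl _ _] pn; apply: (@trans_homog_eq n) => //.
- by do 2 apply: trans_multilinear.
- by move=> w sw; rewrite !trans_neq.
move=> w sw hw; have [u [a [b [v [wE su]]]]] := split_at sw pn; subst w p.
have [i ha] : homogeneous a by apply: hw; rewrite mem_cat inE eqxx orbT.
have [j hb] : homogeneous b by apply: hw; rewrite mem_cat !inE eqxx !orbT.
rewrite (trans_at _ ha hb) //; last exact: trans_multilinear.
rewrite (trans_at _ hb ha) //; last by rewrite -sw !size_cat.
rewrite trans_neq; last by rewrite -sw !size_cat /= !addnS neq_ltn leqnn.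
rewrite [brk a b](brk_skew _ _ _ _ ha hb) multilinearN // multilinearZ //.
by case: (i) (j) => [] [] /=; ring.
Qed.

(** The two orders differ only in words with one bracket; these are shorter than [n], and [respects]
    reorders their other pair. *)
Lemma trans_comm n p q f : good n f -> (p.+1 < q)%N -> (q.+1 < n)%N ->
  trans n p (trans n q f) = trans n q (trans n p f).
Proof.
move=> [fl _ fr] pq qn; apply: (@trans_homog_eq n).
- by do 2 apply: trans_multilinear.
- by do 2 apply: trans_multilinear.
- by move=> w sw; rewrite !trans_neq.
move=> w sw hw; have [u [c [d [x [wE su]]]]] := split_at sw qn; subst w q.
have [t [a [b [v [uE st]]]]] := split_at (erefl (size u)) pq; subst u p.
have mem y : y \in [:: a; b; c; d] -> homogeneous y.
  rewrite !inE => my; apply: hw; move: my.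
  by case/or4P => /eqP ->; rewrite !(mem_cat, inE) eqxx ?orbT.
have [i ha] : homogeneous a by apply: mem; rewrite !inE eqxx ?orbT.
have [j hb] : homogeneous b by apply: mem; rewrite !inE eqxx ?orbT.
have [k hc] : homogeneous c by apply: mem; rewrite !inE eqxx ?orbT.
have [l hd] : homogeneous d by apply: mem; rewrite !inE eqxx ?orbT.
have at_p g y z : multilinear g -> trans n (size t) g (t ++ a :: b :: v ++ y :: z :: x) =
    (-1) ^+ (i && j) * g (t ++ b :: a :: v ++ y :: z :: x)
    + g (t ++ brk a b :: v ++ y :: z :: x).
  move=> gl; apply: trans_at => //; rewrite -sw !size_cat /= !size_cat /=.
  by rewrite -!addnA.
have at_q g y z : multilinear g ->
    trans n (size (t ++ a :: b :: v)) g (t ++ y :: z :: v ++ c :: d :: x) =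
    (-1) ^+ (k && l) * g (t ++ y :: z :: v ++ d :: c :: x)
    + g (t ++ y :: z :: v ++ brk c d :: x).
  move=> gl; rewrite (_ : size (t ++ a :: b :: v) = size (t ++ y :: z :: v)); last first.
    by rewrite !size_cat.
  have -> : t ++ y :: z :: v ++ c :: d :: x = (t ++ y :: z :: v) ++ c :: d :: x.
    by rewrite -catA.
  rewrite (trans_at _ hc hd) //; first by rewrite -!catA.
  by rewrite -sw !size_cat.
have fl' e : multilinear (trans n e f) by apply: trans_multilinear.
have sz1 y : size (t ++ y :: v ++ c :: d :: x) != n.
  by rewrite -sw !size_cat /= !size_cat /=; lia.
have sz2 y : size (t ++ a :: b :: v ++ y :: x) != n.
  by rewrite -sw !size_cat /= !size_cat /=; lia.
rewrite -!catA /= at_p // at_q // at_q // trans_neq //.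
rewrite (at_p f d c) // (trans_neq _ _ (sz2 _)).
rewrite (fr i j a b t (v ++ brk c d :: x)) //; last first.
  by rewrite -sw !size_cat /= !size_cat /=; lia.
have := fr k l c d (t ++ brk a b :: v) x hc hd; rewrite -!catA /= => ->; first by ring.
by rewrite -sw !size_cat /= !size_cat /=; lia.
Qed.

(** The words with one bracket are shorter than [n] and are reordered by [respects]; what remains
    has a double bracket of [a], [b], [c] as a letter and cancels by the Jacobi identity. *)
Lemma trans_braid n p f : good n f -> (p.+2 < n)%N ->
  trans n p (trans n p.+1 (trans n p f)) =
  trans n p.+1 (trans n p (trans n p.+1 f)).
Proof.
move=> [fl _ fr] pn; apply: (@trans_homog_eq n).
- by do 3 apply: trans_multilinear.
- by do 3 apply: trans_multilinear.
- by move=> w sw; rewrite !trans_neq.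
move=> w sw hw; have [u [a [b [v' [wE su]]]]] := split_at sw (ltnW pn); subst w p.
case: v' sw hw => [|c v] sw hw; first by move: pn; rewrite -sw size_cat /=; lia.
have [i ha] : homogeneous a by apply: hw; rewrite !(mem_cat, inE) eqxx ?orbT.
have [j hb] : homogeneous b by apply: hw; rewrite !(mem_cat, inE) eqxx ?orbT.
have [k hc] : homogeneous c by apply: hw; rewrite !(mem_cat, inE) eqxx ?orbT.
have fst g i' j' x y z : homog i' x -> homog j' y -> multilinear g ->
    trans n (size u) g (u ++ x :: y :: z :: v) =
    (-1) ^+ (i' && j') * g (u ++ y :: x :: z :: v) + g (u ++ brk x y :: z :: v).
  by move=> hx hy gl; apply: trans_at => //; rewrite -sw !size_cat.
have snd g i' j' x y z : homog i' y -> homog j' z -> multilinear g ->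
    trans n (size u).+1 g (u ++ x :: y :: z :: v) =
    (-1) ^+ (i' && j') * g (u ++ x :: z :: y :: v) + g (u ++ x :: brk y z :: v).
  move=> hy hz gl; rewrite -(size_rcons u x) -!(cat_rcons x u).
  by apply: trans_at => //; rewrite -sw !size_cat size_rcons /=; lia.
have short e g x y : trans n e g (u ++ x :: y :: v) = g (u ++ x :: y :: v).
  by rewrite trans_neq // -sw !size_cat /=; lia.
have fl' e : multilinear (trans n e f) by apply: trans_multilinear.
have fl2 e e' : multilinear (trans n e (trans n e' f)) by apply: trans_multilinear.
rewrite (fst _ _ _ _ _ _ ha hb (fl2 _ _)) (snd _ _ _ _ _ _ ha hc (fl' _)).
rewrite (fst _ _ _ _ _ _ hb hc fl) !short.
rewrite (snd _ _ _ _ _ _ hb hc (fl2 _ _)) (fst _ _ _ _ _ _ ha hc (fl' _)).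
rewrite (snd _ _ _ _ _ _ ha hb fl) !short.
have R i' j' x y : homog i' x -> homog j' y -> f (u ++ x :: y :: v) =
    (-1) ^+ (i' && j') * f (u ++ y :: x :: v) + f (u ++ brk x y :: v).
  by move=> hx hy; apply: fr => //; rewrite -sw !size_cat /=; lia.
rewrite (R _ _ _ _ (brk_homog _ _ _ _ ha hb) hc).
rewrite (R _ _ _ _ hb (brk_homog _ _ _ _ ha hc)).
rewrite (R _ _ _ _ ha (brk_homog _ _ _ _ hb hc)).
rewrite (brk_jacobi _ _ _ _ _ _ ha hb hc) (multilinearD _ _ _ _ fl).
rewrite (multilinearZ _ _ _ _ fl).
by case: (i) (j) (k) => [] [] [] /=; ring.
Qed.

Lemma good0 n : good n (fun=> 0).
Proof.
by split=> [u v a x y|u x v _|i j a b u v _ _ _]; rewrite ?mulr0 ?addr0.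
Qed.

Lemma good_linear n f g c : good n f -> good n g -> good n (fun w => c * f w + g w).
Proof.
move=> [fl fK fr] [gl gK gr]; split.
- by move=> u v a x y; rewrite fl gl; ring.
- by move=> u x v Kx; rewrite fK // gK // mulr0 addr0.
- move=> i j a b u v ha hb sw; rewrite (fr _ _ _ _ _ _ ha hb sw).
  by rewrite (gr _ _ _ _ _ _ ha hb sw); ring.
Qed.

Lemma trans_linear n p f g c w :
  trans n p (fun s => c * f s + g s) w = c * trans n p f w + trans n p g w.
Proof. by rewrite /trans; case: ifP => _; rewrite ?swap_linear. Qed.

Lemma good_sum n m (g : nat -> seq L -> F) : (forall j, (j < m)%N -> good n (g j)) ->
  good n (fun w => \sum_(j < m) g j w).
Proof.
elim: m => [|m IH] gg.
  rewrite (_ : (fun w => _) = fun=> 0); first exact: good0.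
  by apply/funext => w; rewrite big_ord0.
rewrite (_ : (fun w => _) = fun w => 1 * g m w + \sum_(j < m) g j w).
  by apply: good_linear; [exact: gg | apply: IH => j jm; apply: gg; rewrite ltnW].
by apply/funext => w; rewrite big_ord_recr /= mul1r addrC.
Qed.

Lemma trans0 n p w : trans n p (fun=> 0) w = 0.
Proof. by rewrite /trans swap0 if_same. Qed.

Lemma trans_sum n p m (g : nat -> seq L -> F) w :
  trans n p (fun s => \sum_(j < m) g j s) w = \sum_(j < m) trans n p (g j) w.
Proof.
elim: m => [|m IH].
  rewrite (_ : (fun w => _) = fun=> 0) ?trans0 ?big_ord0 //.
  by apply/funext => s; rewrite big_ord0.
rewrite (_ : (fun w => _) = fun w => 1 * g m w + \sum_(j < m) g j w).
  by rewrite trans_linear IH big_ord_recr /= mul1r addrC.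
by apply/funext => s; rewrite big_ord_recr /= mul1r addrC.
Qed.

Lemma trans_scale n p c f w : trans n p (fun s => c * f s) w = c * trans n p f w.
Proof.
rewrite (_ : (fun s => _) = fun s => c * f s + 0).
  by rewrite (trans_linear n p f (fun=> 0)) trans0 addr0.
by apply/funext => s; rewrite addr0.
Qed.

(** * Averaging over coset representatives and extension degree by degree *)

Section Averaging.
Hypothesis charF0 : [pchar F] =i pred0.

(* If [f] is fixed by the first [k] transpositions, the transpositions permute
   the forms [orbit_form j], which are the images of [f] under representatives
   of the cosets of the symmetric group on [k.+1] letters in the next one; the
   average is then fixed by one more transposition. *)
Fixpoint orbit_form n k f j : seq L -> F :=
  if j is j'.+1 then trans n (k - j') (orbit_form n k f j') else f.

Lemma orbit_form_good n k f j : good n f -> good n (orbit_form n k f j).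
Proof. by move=> gf; elim: j => //= j IH; apply: trans_good. Qed.

Lemma orbit_form_neq n k f j w : size w != n -> orbit_form n k f j w = f w.
Proof. by move=> sw; elim: j => //= j IH; rewrite trans_neq. Qed.

(** For [p + j < k] the transposition commutes past all factors and reaches [f]. For [p + j > k + 1]
    it meets the factor [p - 1], and the braid relation turns it into the transposition [p - 1],
    which then passes through as in the first case. *)
Lemma orbit_form_fixed n k f j p : good n f -> (k.+1 < n)%N ->
  (forall q, (q < k)%N -> trans n q f = f) ->
  (p <= k)%N -> (j <= k.+1)%N -> (p + j != k)%N -> (p + j != k.+1)%N ->
  trans n p (orbit_form n k f j) = orbit_form n k f j.
Proof.
move=> gf kn ff; have gg j' := orbit_form_good k j' gf.
have low j' p' : (p' + j' < k)%N ->
    trans n p' (orbit_form n k f j') = orbit_form n k f j'.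
  elim: j' => [|j' IH] /= lt; first by apply: ff; rewrite addn0 in lt.
  by rewrite trans_comm ?IH //; lia.
move=> pk jk ne1 ne2; have [/low//|ge] := ltnP (p + j) k.
have {ne1 ne2 ge} : (k.+1 < p + j)%N by lia.
elim: j jk => [|j IH] jk gt /=; first by lia.
have [jE|jE] := eqVneq (p + j)%N k.+1; last first.
  by rewrite -trans_comm ?IH //; lia.
case: j IH jk gt jE => [|j] IH jk gt jE /=; first by lia.
have -> : (k - j)%N = (k - j.+1).+1 by lia.
have -> : p = (k - j.+1).+1 by lia.
rewrite -trans_braid //; last by lia.
by rewrite low //; lia.
Qed.

Lemma fixed_form n k f : (k < n)%N -> good n f ->
  exists f', [/\ good n f', forall w, size w != n -> f' w = f w &
    forall p, (p < k)%N -> trans n p f' = f'].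
Proof.
move=> kn gf; elim: k kn => [|k IH] kn; first by exists f.
have {IH} [f1 [gf1 ff1 fixf1]] := IH (ltnW kn).
pose g := orbit_form n k f1.
have gg j : good n (g j) by apply: orbit_form_good.
exists (fun w => k.+2%:R^-1 * \sum_(j < k.+2) g j w); split.
- rewrite (_ : (fun w => _) = fun w => k.+2%:R^-1 * \sum_(j < k.+2) g j w + 0).
    by apply: good_linear (good0 n); apply: good_sum.
  by apply/funext => w; rewrite addr0.
- move=> w sw; rewrite (eq_bigr (fun=> f1 w)) => [|j _]; last exact: orbit_form_neq.
  rewrite sumr_const card_ord -[f1 w *+ _]mulr_natl mulrA mulVf ?mul1r ?ff1 //.
  exact: natr_neq0 charF0 _.
move=> p pk; apply/funext => w.
rewrite trans_scale trans_sum; congr (_ * _).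
have l1 : (k - p < k.+2)%N by lia.
have l2 : ((k - p).+1 < k.+2)%N by lia.
(* The transposition [p] exchanges the forms with indices [k - p] and [(k - p).+1] and fixes the
   others, so it permutes the terms of the sum. *)
rewrite (reindex_inj (@perm_inj _ (tperm (Ordinal l1) (Ordinal l2)))) /=.
apply: eq_bigr => j _.
case: tpermP => [->|->|/eqP jl1 /eqP jl2] /=.
- rewrite -/(g _) /g /= (_ : (k - (k - p))%N = p); last by lia.
  by rewrite trans_involutive //; lia.
- by rewrite /g /= (_ : (k - (k - p))%N = p); last by lia.
move: jl1 jl2; rewrite -!val_eqE /= => jl1 jl2.
rewrite /g orbit_form_fixed //; have := ltn_ord j; lia.
Qed.

(** A form fixed by all transpositions in degree [n] satisfies the relations on words of that
    length. For [n = 0] there is nothing to repair, as a relation involves two letters. *)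
Lemma extend_good n f : good n f ->
  exists f', good n.+1 f' /\ forall w, size w != n -> f' w = f w.
Proof.
case: n => [|n] gf.
  exists f; split=> //; case: gf => fl fK _; split=> // i j a b u v _ _.
  by rewrite size_cat /=; lia.
have [f' [gf' ff' fixf']] := fixed_form (ltnSn n) gf.
exists f'; split=> //; case: gf' => fl fK fr; split=> // i j a b u v ha hb.
rewrite ltnS leq_eqVlt => /orP[/eqP sw|]; last exact: fr.
rewrite -{1}(fixf' (size u)); first exact: trans_at.
by move: sw; rewrite size_cat /=; lia.
Qed.

Lemma extend_all m f : good m f ->
  exists f', [/\ forall n, good n f' & forall w, (size w < m)%N -> f' w = f w].
Proof.
move=> gf.
(* The hypothesis [good n g] is moved under the existential so that the choice is total and can be
   iterated. *)
have step n g : exists g', good n g ->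
    good n.+1 g' /\ forall w, size w != n -> g' w = g w.
  have [gg|ng] := pselect (good n g); last by exists g.
  by have [g' gg'] := extend_good gg; exists g'.
pose G := fix G k := if k is k'.+1 then projT1 (cid (step (m + k')%N (G k'))) else f.
have GS k : good (m + k)%N (G k) ->
    good (m + k).+1 (G k.+1) /\ forall w, size w != (m + k)%N -> G k.+1 w = G k w.
  exact: (projT2 (cid (step (m + k)%N (G k)))).
have Ggood k : good (m + k)%N (G k).
  by elim: k => [|k IH]; [rewrite addn0 | rewrite addnS; case: (GS _ IH)].
have Gstab k d w : (size w < m + k)%N -> G (k + d)%N w = G k w.
  move=> sw; elim: d => [|d IH]; first by rewrite addn0.
  rewrite addnS; case: (GS _ (Ggood (k + d)%N)) => _ ->; first exact: IH.
  by lia.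
(* [G k] is final on words shorter than [m + k], so stage [(size w).+1] is late enough for [w]. *)
pose h w := G (size w).+1 w.
have hE k w : (size w < m + k)%N -> h w = G k w.
  move=> sw; rewrite /h; case: (leqP k (size w).+1) => kw.
    by rewrite -(subnKC kw) Gstab.
  by rewrite -(subnKC (ltnW kw)) Gstab //; lia.
exists h; split=> [n|w sw]; last by rewrite (hE 0) // addn0.
split.
- move=> u v a x y; have sw z : (size (u ++ z :: v) < m + (size (u ++ v)).+2)%N.
    by rewrite !size_cat /=; lia.
  by rewrite !(hE _ _ (sw _)); case: (Ggood (size (u ++ v)).+2).
- by move=> u x v Kx; rewrite /h; case: (Ggood (size (u ++ x :: v)).+1) => _ GK _; apply: GK.
- move=> i j a b u v ha hb _; pose k := (size (u ++ v)).+3.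
  have sw2 x y : (size (u ++ x :: y :: v) < m + k)%N.
    by rewrite /k !size_cat /=; lia.
  have sw1 x : (size (u ++ x :: v) < m + k)%N by rewrite /k !size_cat /=; lia.
  rewrite !(hE _ _ (sw2 _ _)) (hE _ _ (sw1 _)).
  by case: (Ggood k) => _ _; apply.
Qed.

(* The degree [m] part of the Poincare-Birkhoff-Witt theorem, relative to an
   ideal of odd elements. *)
Theorem pbw_functional m (g : seq L -> F) :
  multilinear g -> vanishes g ->
  (forall i j a b u v, homog i a -> homog j b -> size (u ++ a :: b :: v) = m ->
     g (u ++ a :: b :: v) = (-1) ^+ (i && j) * g (u ++ b :: a :: v)) ->
  exists phi : {scalar env_alg L},
    [/\ forall w, size w = m -> phi (word (@env_in F L) w) = g w,
        forall w, (size w < m)%N -> phi (word (@env_in F L) w) = 0 &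
        forall u x v, K x -> phi (word (@env_in F L) (u ++ x :: v)) = 0].
Proof.
move=> gl gK gs; pose f w := if size w == m then g w else 0.
(* On words of length [m] the bracket term has length [m - 1], where [f] is zero, so the symmetry of
   [g] is the whole relation. *)
have gf : good m.+1 f.
  split.
  - move=> u v a x y; rewrite /f !size_cat /=; case: eqP => _; first exact: gl.
    by rewrite mulr0 addr0.
  - by move=> u x v Kx; rewrite /f gK // if_same.
  - move=> i j a b u v ha hb; rewrite ltnS => sw.
    rewrite /f (_ : size (u ++ b :: a :: v) = size (u ++ a :: b :: v)).
      rewrite (_ : size (u ++ brk a b :: v) == m = false).
        rewrite addr0; case: eqP => [sm|_]; first exact: gs.
        by rewrite mulr0.
      by move: sw; rewrite !size_cat /=; lia.
    by rewrite !size_cat.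
have [h [gh hf]] := extend_all gf.
have hl : multilinear h by case: (gh 0%N).
have [|phi phiE] := env_functional hl.
  by move=> i j a b u v ha hb; case: (gh (size (u ++ a :: b :: v)).+1) => _ _; apply.
exists phi; split=> [w sw|w sw|u x v Kx]; rewrite phiE.
- by rewrite hf ?sw // /f sw eqxx.
- by rewrite hf ?ltnS ?(ltnW sw) // /f ltn_eqF.
- by case: (gh 0%N) => _ hK _; apply: hK.
Qed.

End Averaging.
End Transpositions.

(** * Algebras with the Engel condition *)

Section EngelAlgebra.
Variables (F : fieldType) (charF0 : [pchar F] =i pred0) (R : algType F).
Implicit Types (x y z a g : R).

Definition engel (n : nat) : Prop :=
  forall x y, iter n (fun z => comm_br z y) x = 0.

Local Notation D a := (fun z => comm_br z a).

Lemma iter_commB a k x y : iter k (D a) (x + y) = iter k (D a) x + iter k (D a) y.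
Proof.
elim: k => //= k ->; rewrite /comm_br mulrDl mulrDr opprD.
by rewrite addrACA.
Qed.

Lemma iter_comm0 a k : iter k (D a) 0 = 0.
Proof. by elim: k => //= k ->; rewrite /comm_br mul0r mulr0 subrr. Qed.

Lemma comm_brM a x y : comm_br (x * y) a = x * comm_br y a + comm_br x a * y.
Proof.
by rewrite /comm_br mulrBr mulrBl !mulrA addrA subrK.
Qed.

Lemma engelS n m : engel n -> (n <= m)%N -> engel m.
Proof. by move=> En nm x y; rewrite -(subnK nm) iterD En iter_comm0. Qed.

Lemma natr_alg_eq0 n x : n.+1%:R * x = 0 -> x = 0.
Proof.
move=> nx0; rewrite -[x]scale1r -(mulVf (natr_neq0 charF0 n)) -scalerA.
by rewrite scaler_nat -[x *+ _]mulr_natl nx0 scaler0.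
Qed.

Lemma fact_alg_eq0 n x : n`!%:R * x = 0 -> x = 0.
Proof. by rewrite -(prednK (fact_gt0 n)); apply: natr_alg_eq0. Qed.

Lemma iter_comm_mul a k x y : comm_br (comm_br y a) a = 0 ->
  iter k.+1 (D a) (y * x) =
  y * iter k.+1 (D a) x + k.+1%:R * (comm_br y a * iter k (D a) x).
Proof.
move=> Dy; elim: k => [|k IH]; first by rewrite /= comm_brM mul1r.
rewrite [LHS]/= -/(iter k.+1 (D a) (y * x)) IH.
have DD u v : comm_br (u + v) a = comm_br u a + comm_br v a.
  exact: (iter_commB a 1).
have Dn m u : comm_br (m%:R * u) a = m%:R * comm_br u a.
  by rewrite comm_brM /comm_br [m%:R * a]mulr_natl [a * m%:R]mulr_natr subrr mul0r addr0.
rewrite DD Dn comm_brM [comm_br (comm_br y a * _) a]comm_brM Dy mul0r addr0 /=.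
by rewrite -addrA; congr (_ + _); rewrite [in RHS]mulrS [RHS]mulrDl mul1r.
Qed.

(** By the Leibniz rule only the terms in which every factor is differentiated exactly once survive,
    and there are [(size s)!] orders of doing so. One more derivation leaves nothing, which carries
    the induction. *)
Lemma iter_comm_prod a (s : seq R) :
  (forall y, y \in s -> comm_br (comm_br y a) a = 0) ->
  iter (size s) (D a) (\prod_(y <- s) y) = (size s)`!%:R * \prod_(y <- s) comm_br y a
  /\ iter (size s).+1 (D a) (\prod_(y <- s) y) = 0.
Proof.
elim: s => [|y s IH] Ds.
  by rewrite !big_nil mulr1 /= /comm_br mul1r mulr1 subrr.
have [|IH1 IH2] := IH; first by move=> z sz; apply: Ds; rewrite inE sz orbT.
have Dy : comm_br (comm_br y a) a = 0 by apply: Ds; rewrite inE eqxx.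
rewrite !big_cons [size (y :: s)]/= !iter_comm_mul // IH2 IH1.
have -> : iter (size s).+2 (D a) (\prod_(j <- s) j) = 0.
  by rewrite [LHS]/= -/(iter (size s).+1 (D a) _) IH2 /comm_br mul0r mulr0 subrr.
split; last by rewrite !mulr0 addr0.
rewrite mulr0 add0r factS natrM -mulrA; congr (_ * _).
by rewrite !mulrA [_ * _%:R]mulr_natr mulr_natl.
Qed.

Lemma engel_prod n a (s : seq R) : engel n -> (n <= size s)%N ->
  (forall y, y \in s -> comm_br (comm_br y a) a = 0) ->
  \prod_(y <- s) comm_br y a = 0.
Proof.
move=> En ns Ds; apply: (@fact_alg_eq0 (size s)).
by case: (iter_comm_prod Ds) => <- _; apply: (engelS En ns).
Qed.

(** The element [z = w y - v x] anticommutes with [x], so [[[z, x], x] = 4 x^2 z = 2 w z], and [2 n]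
    commutators give [(2 w)^n z]. *)
Lemma engel_clifford n x y v w : engel n ->
  x * x + x * x = w -> x * y + y * x = v -> w * y = y * w -> v * x = x * v ->
  w ^+ n * (w * y - v * x) = 0.
Proof.
move=> En xx xy wy vx.
have [z zw] : exists z, z = w * y - v * x by exists (w * y - v * x).
have [c cE] : exists c, c = x * x by exists (x * x).
rewrite -zw; rewrite -cE in xx.
have two (u u' : R) : u + u = u' + u' -> u = u'.
  move=> /eqP; rewrite -subr_eq0 opprD addrACA => /eqP uu.
  apply/eqP; rewrite -subr_eq0; apply/eqP; apply: (@natr_alg_eq0 1).
  by rewrite mulr_natl mulr2n.
have cy : c * y = y * c.
  by apply: two; rewrite -mulrDl -mulrDr xx.
have cv : c * v = v * c by rewrite cE -mulrA -vx mulrA -vx mulrA.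
have cx : c * x = x * c by rewrite cE mulrA.
have cz : c * z = z * c.
  rewrite zw -xx; apply: commrB; apply: commrM => //.
  exact: commrD.
have xyx : x * y * x = v * x - c * y.
  have yx : y * x = v - x * y by rewrite -xy addrAC subrr add0r.
  by rewrite -mulrA yx mulrBr mulrA -vx cE.
have xzx : x * z * x = - (c * z).
  have zE : z = c * y + c * y - v * x by rewrite zw -xx mulrDl.
  have e1 : x * (c * y) * x = c * (v * x - c * y).
    by rewrite mulrA -cx -!mulrA -xyx !mulrA.
  have e2 : x * (v * x) * x = c * (v * x).
    by rewrite [x * _]mulrA -vx -[LHS]mulrA -cE [RHS]mulrA cv -!mulrA cx.
  rewrite {1}zE mulrBr mulrDr mulrBl mulrDl e1 e2 -mulrDr -mulrBr -[RHS]mulrN.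
  congr (c * _); rewrite zE opprB opprD addrAC.
  by rewrite [v * x - c * y - v * x]addrAC subrr add0r addrCA.
have D2 : comm_br (comm_br z x) x = 4%:R * c * z.
  rewrite /comm_br mulrBl mulrBr -mulrA -cE [x * (x * z)]mulrA -cE [x * (z * x)]mulrA xzx.
  rewrite opprB opprK -cz addrA addrAC.
  by rewrite -!mulrA [4%:R * _]mulr_natl !mulrS mulr0n addr0 !addrA.
have fourc : comm_br (4%:R * c) x = 0.
  by rewrite comm_brM /comm_br cx subrr mulr0 add0r mulr_natl mulr_natr subrr mul0r.
have D2n m : iter (m + m) (D x) z = (4%:R * c) ^+ m * z.
  elim: m => [|m IH]; first by rewrite mul1r.
  have p0 : comm_br ((4%:R * c) ^+ m) x = 0.
    elim: m {IH} => [|m IH]; first by rewrite /comm_br mul1r mulr1 subrr.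
    by rewrite exprS comm_brM IH fourc mulr0 mul0r addr0.
  rewrite addnS addSn [LHS]/= IH comm_brM p0 mul0r addr0 comm_brM p0 mul0r addr0.
  by rewrite D2 exprSr mulrA.
have : iter (n + n) (D x) z = 0 by apply: (engelS En); rewrite leq_addr.
rewrite D2n (_ : 4%:R * c = 2%:R * w); last first.
  by rewrite -xx !mulr_natl mulrnDl -mulrnDr.
rewrite exprMn_comm; last exact/commr_sym/commr_nat.
rewrite -natrX -mulrA -(prednK (expn_gt0 2 n : 0 < 2 ^ n)%N).
exact: natr_alg_eq0.
Qed.

Definition anticomm x y : Prop := x * y = - (y * x).

Lemma anticomm_sym x y : anticomm x y -> anticomm y x.
Proof. by rewrite /anticomm => ->; rewrite opprK. Qed.

Lemma anticomm_sum (I : Type) (r : seq I) (E : I -> R) x :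
  (forall i, anticomm x (E i)) -> anticomm x (\sum_(i <- r) E i).
Proof.
move=> xE; rewrite /anticomm mulr_sumr mulr_suml -sumrN.
by apply: eq_bigr => i _; apply: xE.
Qed.

Lemma anticommM a x y : a * y = y * a -> anticomm x y -> anticomm (a * x) y.
Proof.
by move=> ay xy; rewrite /anticomm -mulrA xy mulrN [a * (y * x)]mulrA ay mulrA.
Qed.

Lemma anticomm_comm x y z : anticomm x z -> anticomm y z -> GRing.comm z (x * y).
Proof.
by move=> xz yz; rewrite /GRing.comm -mulrA yz mulrN [x * (z * y)]mulrA xz mulNr opprK mulrA.
Qed.

Lemma anticomm_sqr x : anticomm x x -> x * x = 0.
Proof.
move=> xx; apply: (@natr_alg_eq0 1); rewrite mulr_natl mulr2n {1}xx.
by rewrite addNr.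
Qed.

(** In the multinomial expansion only squarefree monomials survive. *)
Lemma sum_square_zero_exp N (e : nat -> R) :
  (forall i j, GRing.comm (e i) (e j)) -> (forall i, e i * e i = 0) ->
  (\sum_(i < N) e i) ^+ N = N`!%:R * \prod_(i < N) e i /\
  (\sum_(i < N) e i) ^+ N.+1 = 0.
Proof.
move=> ec ee; elim: N => [|N [IH1 IH2]].
  by rewrite !big_ord0 mulr1 expr1.
rewrite !big_ord_recr /=; set s := \sum_(i < N) e i in IH1 IH2 *.
have se : GRing.comm (e N) s by apply: commr_sum => i _; apply: ec.
have es k : (s + e N) ^+ k.+1 = s ^+ k.+1 + k.+1%:R * (s ^+ k * e N).
  elim: k => [|k IHk]; first by rewrite !expr1 expr0 !mul1r.
  rewrite exprSr IHk mulrDl !mulrDr -!exprSr -[k.+1%:R * _ * s]mulrA.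
  rewrite -[s ^+ k * _ * s]mulrA se [s ^+ k * _]mulrA -exprSr.
  rewrite -[k.+1%:R * _ * e N]mulrA -[_ * e N * e N]mulrA ee !mulr0 addr0.
  by rewrite -addrA; congr (_ + _); rewrite [in RHS]mulrS [RHS]mulrDl mul1r.
have s2 : s ^+ N.+2 = 0 by rewrite exprS IH2 mulr0.
rewrite !es s2 IH2 IH1 !add0r factS natrM.
split; last by rewrite mul0r mulr0.
by rewrite !mulrA.
Qed.

Section Zeta.
(** In the application [A i] and [a0] are images of even elements and [y] of an odd one, with [Z i =
    [A i, y]] and [z0 = [a0, y]]; the [S i] are further odd elements commuting with the [A i]. *)
Variables (n : nat) (A S Z : nat -> R) (a0 y z0 : R).
Hypotheses (AA : forall i j, GRing.comm (A i) (A j)) (a0A : forall i, GRing.comm a0 (A i)).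
Hypotheses (AS : forall i j, GRing.comm (A i) (S j)) (AZ : forall i j, GRing.comm (A i) (Z j)).
Hypotheses (Az0 : forall i, GRing.comm (A i) z0) (a0S : forall i, GRing.comm a0 (S i)).
Hypotheses (Ay : forall i, A i * y = y * A i + Z i) (a0y : a0 * y = y * a0 + z0).
Hypotheses (SS : forall i j, anticomm (S i) (S j)) (ZZ : forall i j, anticomm (Z i) (Z j)).
Hypotheses (SZ : forall i j, anticomm (S i) (Z j)).
Hypotheses (Sy : forall i, anticomm (S i) y) (Zy : forall i, anticomm (Z i) y).
Hypotheses (Sz0 : forall i, anticomm (S i) z0) (Zz0 : forall i, anticomm (Z i) z0).
Hypothesis z0y : anticomm z0 y.

(* For [g = h * y] with [h = \sum_i A i * S i], the commutators
   [[a0, g, ..., g]] are [zeta ^+ k * h * z0] with [zeta = \sum_i Z i * S i]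
   central, and a last commutator with [y] turns [h] into [zeta]. *)
Lemma engel_zeta : engel n -> \prod_(i < n.+1) (Z i * S i) * z0 = 0.
Proof.
move=> En.
have [h hE] : exists h, h = \sum_(i < n.+1) A i * S i by eexists.
have [t tE] : exists t, t = \sum_(i < n.+1) Z i * S i by eexists.
have hanti x : (forall i, GRing.comm (A i) x) -> (forall i, anticomm (S i) x) ->
    anticomm h x.
  move=> Ax Sx; rewrite hE; apply/anticomm_sym/anticomm_sum => i.
  by apply/anticomm_sym/anticommM; [apply: Ax | apply: Sx].
(* [h] anticommutes with each summand [A i * S i], hence with itself. *)
have hh : h * h = 0.
  apply: anticomm_sqr; rewrite {2}hE; apply: anticomm_sum => i.
  apply/anticomm_sym/anticommM.
    by rewrite hE; apply: commr_sum => j _; apply: commrM; [exact: AA | exact: AS].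
  by apply/anticomm_sym/hanti => j; [exact: AS | exact: SS].
have hz0 : anticomm h z0 by apply: hanti.
have hy : h * y + y * h = - t.
  rewrite hE tE mulr_suml mulr_sumr -big_split -sumrN /=; apply: eq_bigr => i _.
  by rewrite -mulrA Sy mulrN [A i * (y * _)]mulrA Ay mulrDl !mulrA opprD addrAC addNr add0r.
have ty : GRing.comm t y.
  by rewrite tE; apply/commr_sym/commr_sum => i _; apply: anticomm_comm.
have th : GRing.comm t h.
  rewrite hE; apply: commr_sum => i _; apply: commrM.
    rewrite tE; apply/commr_sym/commr_sum => j _; apply: commrM; [exact: AZ|exact: AS].
  rewrite tE; apply/commr_sym/commr_sum => j _; apply: anticomm_comm => //.
  exact/anticomm_sym/SZ.
have tg : comm_br t (h * y) = 0.
  by apply/eqP; rewrite subr_eq0; apply/eqP/commrM.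
have tkg k : comm_br (t ^+ k) (h * y) = 0.
  elim: k => [|k IH]; first by rewrite /comm_br mul1r mulr1 subrr.
  by rewrite exprS comm_brM IH tg mulr0 mul0r addr0.
have a0h : GRing.comm a0 h.
  by rewrite hE; apply: commr_sum => i _; apply: commrM.
have D1 : comm_br a0 (h * y) = h * z0.
  by rewrite /comm_br mulrA a0h -!mulrA a0y mulrDr addrAC subrr add0r.
have D2 : comm_br (h * z0) (h * y) = t * (h * z0).
  have yh : y * h = - t - h * y by rewrite -hy addrAC subrr add0r.
  rewrite /comm_br [h * z0 * _]mulrA -[h * z0 * h]mulrA.
  rewrite (anticomm_sym hz0) mulrN [h * (h * z0)]mulrA hh mul0r oppr0 mul0r sub0r.
  rewrite -[h * y * _]mulrA [y * (h * z0)]mulrA yh mulrBl mulrBr.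
  rewrite -[h * y * z0]mulrA [h * (h * _)]mulrA hh mul0r subr0 mulNr mulrN opprK.
  by rewrite mulrA -th -mulrA.
have Dk k : iter k.+1 (D (h * y)) a0 = t ^+ k * (h * z0).
  elim: k => [|k IH]; first by rewrite mul1r.
  by rewrite [LHS]/= -/(iter k.+1 (D (h * y)) a0) IH comm_brM tkg mul0r addr0 D2 mulrA -exprSr.
have tn : t ^+ n * (h * z0) = 0 by rewrite -Dk; apply: (engelS En).
have tnz : t ^+ n.+1 * z0 = 0.
  have : comm_br (t ^+ n * (h * z0)) y = 0 by rewrite tn /comm_br mul0r mulr0 subrr.
  have tny : comm_br (t ^+ n) y = 0.
    by apply/eqP; rewrite subr_eq0; apply/eqP/commr_sym/commrX/commr_sym.
  rewrite comm_brM tny mul0r addr0 => <-; rewrite exprSr -mulrA; congr (_ * _).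
  rewrite /comm_br -[h * z0 * y]mulrA z0y mulrN !mulrA -opprD -mulrDl hy.
  by rewrite mulNr opprK.
(* The products [Z i * S i] commute and square to zero, so [t ^+ n.+1] is a factorial multiple of
   their product. *)
apply: (@fact_alg_eq0 n.+1); rewrite mulrA.
have [||<- _] := @sum_square_zero_exp n.+1 (fun i => Z i * S i).
- move=> i j; apply: commrM.
    by apply/commr_sym/anticomm_comm; [exact: ZZ | exact: SZ].
  by apply/commr_sym/anticomm_comm; [exact/anticomm_sym/SZ | exact: SS].
- move=> i; rewrite -mulrA [S i * _]mulrA SZ mulNr mulrN !mulrA.
  by rewrite (anticomm_sqr (ZZ i i)) !mul0r oppr0.
by rewrite -tE.
Qed.

End Zeta.
End EngelAlgebra.

(** In characteristic zero the numbers below [size p] are distinct roots, one more than the degree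
    allows. *)
Lemma poly_eq0_horner (F : fieldType) (charF0 : [pchar F] =i pred0) (p : {poly F}) :
  (forall t, p.[t] = 0) -> p = 0.
Proof.
move=> p0; apply/eqP; apply/negPn/negP => pn0.
pose s := [seq i%:R : F | i <- iota 0 (size p)].
have := max_poly_roots pn0 (rs := s); rewrite size_map size_iota ltnn => h.
suff : false by []; apply: h.
  by apply/allP => x _; rewrite /root p0.
rewrite map_inj_uniq ?iota_uniq // => i j /eqP ij.
wlog le : i j ij / (i <= j)%N.
  by case/orP: (leq_total i j) => le H; [apply: H | apply/esym/H; rewrite // eq_sym].
have : ((j - i)%:R : F) == 0 by rewrite natrB // (eqP ij) subrr.
have /pcharf0P -> := charF0; rewrite subn_eq0 => ji.
by apply/eqP; rewrite eqn_leq le ji.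
Qed.

(** * Functionals separating products *)

Lemma prodr_nseq (R : pzRingType) (I : Type) n (x : I) (f : I -> R) :
  \prod_(i <- nseq n x) f i = f x ^+ n.
Proof. by rewrite big_nseq; elim: n => //= n ->; rewrite exprS. Qed.

Section AlternatingForm.
Variables (F : fieldType) (L : lieSuperalgType F).
Implicit Types (u v w : seq L) (phi : nat -> {scalar L}).

Definition value_mx m phi w : 'M[F]_m := \matrix_(i, j) phi j (w`_i).

(** For odd letters a supersymmetric form is an alternating one, and determinants of functionals are
    the alternating forms that detect linear independence. *)
Definition alt_form m phi w : F :=
  if size w == m then \det (value_mx m phi w) else 0.

Lemma nth_cat_neq u v x y (i : nat) : i != size u -> (u ++ x :: v)`_i = (u ++ y :: v)`_i.
Proof.
rewrite !nth_cat; case: ltngtP => // lt _.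
case e: (i - size u)%N => [|k] //.
by move/eqP: e; rewrite subn_eq0 leqNgt lt.
Qed.

Lemma nth_cat_size u v x : (u ++ x :: v)`_(size u) = x.
Proof. by rewrite nth_cat ltnn subnn. Qed.

Lemma alt_form_multilinear m phi : multilinear (alt_form m phi).
Proof.
move=> u v c x y; rewrite /alt_form !size_cat /=; case: eqP => [sz|_]; last first.
  by rewrite mulr0 addr0.
have lt : (size u < m)%N by rewrite -sz addnS ltnS leq_addr.
rewrite (determinant_multilinear (i0 := Ordinal lt) (b := c) (c := 1)
  (B := value_mx m phi (u ++ x :: v)) (C := value_mx m phi (u ++ y :: v))) ?mul1r //.
- by apply/rowP => j; rewrite !mxE !nth_cat_size linearP mul1r.
- apply/matrixP => i j; rewrite !mxE (@nth_cat_neq _ _ _ (c *: x + y)) //.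
  by rewrite eq_sym (neq_lift (Ordinal lt) i).
- apply/matrixP => i j; rewrite !mxE (@nth_cat_neq _ _ _ (c *: x + y)) //.
  by rewrite eq_sym (neq_lift (Ordinal lt) i).
Qed.

Lemma alt_form0 m phi u x v : (forall j, phi j x = 0) -> alt_form m phi (u ++ x :: v) = 0.
Proof.
move=> px; rewrite /alt_form size_cat /=; case: eqP => // sz.
have lt : (size u < m)%N by rewrite -sz addnS ltnS leq_addr.
rewrite (determinant_multilinear (i0 := Ordinal lt) (b := 0) (c := 0)
  (B := value_mx m phi (u ++ x :: v)) (C := value_mx m phi (u ++ x :: v))) ?mul0r ?addr0 //.
by apply/rowP => j; rewrite !mxE nth_cat_size /= px !mul0r addr0.
Qed.

Lemma alt_form_swap m phi u a b v :
  alt_form m phi (u ++ a :: b :: v) = - alt_form m phi (u ++ b :: a :: v).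
Proof.
rewrite /alt_form !size_cat /=; case: eqP => [sz|_]; last by rewrite oppr0.
have lt0 : (size u < m)%N by rewrite -sz addnS ltnS leq_addr.
have lt1 : ((size u).+1 < m)%N by rewrite -sz !addnS !ltnS leq_addr.
pose i0 := Ordinal lt0; pose i1 := Ordinal lt1.
rewrite (_ : value_mx m phi (u ++ a :: b :: v) =
  row_perm (tperm i0 i1) (value_mx m phi (u ++ b :: a :: v))).
  rewrite row_permE det_mulmx det_perm odd_tperm -val_eqE /=.
  by rewrite ltn_eqF // expr1 mulN1r.
have nth0 x y : (u ++ x :: y :: v)`_(size u) = x by rewrite nth_cat_size.
have nth1 x y : (u ++ x :: y :: v)`_(size u).+1 = y.
  by rewrite -cat_rcons -(size_rcons u x) nth_cat_size.
apply/matrixP => i j; rewrite !mxE; case: tpermP => [->|->|ne0 ne1].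
- by rewrite nth0 nth1.
- by rewrite nth0 nth1.
congr (phi j _); rewrite !nth_cat; case: ltngtP => // [lt|ei].
  case e: (i - size u)%N => [|[|k]] //.
    by move/eqP: e; rewrite subn_eq0 leqNgt lt.
  by case: ne1; apply: val_inj => /=; rewrite -(subnK (ltnW lt)) e.
by case: ne0; apply: val_inj.
Qed.

End AlternatingForm.

Section Functionals.
Variables (F : fieldType) (charF0 : [pchar F] =i pred0) (L : lieSuperalgType F).
Local Notation j := (@env_in F L).

Section Ideal.
Variable K : set L.
Hypothesis oddK : forall x, K x -> homog true x.
Hypothesis brkKl : forall x y, K x -> K (brk x y).
Hypothesis brkKr : forall x y, K y -> K (brk x y).

Lemma alternating_functional m (phi : nat -> {scalar L}) :
  (forall i x, homog false x -> phi i x = 0) -> (forall i x, K x -> phi i x = 0) ->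
  exists Phi : {scalar env_alg L},
    (forall w, size w = m -> Phi (word j w) = \det (value_mx m phi w)) /\
    (forall u x v, K x -> Phi (word j (u ++ x :: v)) = 0).
Proof.
move=> phi0 phiK.
have [||i k a b u v ha hb sz|Phi [Phim _ PhiK]] :=
  pbw_functional oddK brkKl brkKr charF0 (m := m) (g := alt_form m phi).
- exact: alt_form_multilinear.
- by move=> u x v Kx; apply: alt_form0 => i; apply: phiK.
- have even x u' v' : homog false x -> alt_form m phi (u' ++ x :: v') = 0.
    by move=> hx; apply: alt_form0 => l; apply: phi0.
  case: i ha => ha; last by rewrite even // -cat_rcons even // mulr0.
  case: k hb => hb; last by rewrite -cat_rcons even // even // mulr0.
  by rewrite alt_form_swap expr1 mulN1r.
exists Phi; split=> [w sw|u x v Kx]; last exact: PhiK.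
by rewrite Phim // /alt_form sw eqxx.
Qed.

End Ideal.

Local Notation K0 := [set 0 : L].
Lemma brk0l y : brk (0 : L) y = 0.
Proof. by have := brk_linearl (-1) 0 0 y; rewrite scaler0 addr0 scaleN1r addNr. Qed.

Lemma brk0r y : brk y (0 : L) = 0.
Proof. by have := brk_linearr (-1) y 0 0; rewrite scaler0 addr0 scaleN1r addNr. Qed.

Lemma zero_odd x : K0 x -> homog true x.
Proof. by move=> /= ->; apply: subspace0; apply: homog_subspace. Qed.

Lemma zero_brkl x y : K0 x -> K0 (brk x y).
Proof. by move=> /= ->; rewrite brk0l. Qed.

Lemma zero_brkr x y : K0 y -> K0 (brk x y).
Proof. by move=> /= ->; rewrite brk0r. Qed.

Lemma multilinear_vanishes0 (g : seq L -> F) : multilinear g -> vanishes K0 g.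
Proof. by move=> gl u x v ->; apply: multilinear0. Qed.

Definition pbw0 := pbw_functional zero_odd zero_brkl zero_brkr charF0.

(** The case of degree one: a functional with value 1 at [x] extends to [U(L)]. *)
Lemma env_in_inj x : j x = 0 -> x = 0.
Proof.
move=> jx; have [//|x0] := pselect (x = 0).
have [phi [phix _]] := separating_functional (subspace_set0 L) x0.
pose g (w : seq L) := if w is [:: y] then phi y else 0.
have gl : multilinear g.
  move=> [|y [|y' u]] [|z v] a b c //=; rewrite ?mulr0 ?addr0 //.
  exact: linearP.
have [i k a b u v _ _|Phi [Phi1 _ _]] := pbw0 (m := 1) gl (multilinear_vanishes0 gl).
  by rewrite size_cat /= !addnS.
have := Phi1 [:: x] (erefl _); rewrite /word big_seq1 jx raddf0 /g phix => /eqP.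
by rewrite eq_sym oner_eq0.
Qed.

Definition prod_form (phi : L -> F) (w : seq L) : F := \prod_(x <- w) phi x.

(** The derivative of the power [prod_form phi] in the direction [psi]: exactly one letter is
    evaluated by [psi]. It detects products of even elements with one odd element. *)
Fixpoint deriv_form (phi psi : L -> F) (w : seq L) : F :=
  if w is x :: w' then psi x * prod_form phi w' + phi x * deriv_form phi psi w' else 0.

Lemma prod_form_cons phi x w : prod_form phi (x :: w) = phi x * prod_form phi w.
Proof. by rewrite /prod_form big_cons. Qed.

Lemma prod_form_multilinear (phi : {scalar L}) : multilinear (prod_form phi).
Proof.
move=> u v a x y; elim: u => [|z u IH] /=; rewrite !prod_form_cons.
  by rewrite linearP mulrDl mulrA.
by rewrite IH; ring.
Qed.

Lemma deriv_form_multilinear (phi psi : {scalar L}) : multilinear (deriv_form phi psi).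
Proof.
move=> u v a x y; elim: u => [|z u IH] /=.
  by rewrite !linearP /=; ring.
by rewrite IH prod_form_multilinear; ring.
Qed.

Lemma deriv_form_swap phi psi u a b v :
  deriv_form phi psi (u ++ a :: b :: v) = deriv_form phi psi (u ++ b :: a :: v).
Proof.
elim: u => [|x u IH] /=; first by rewrite !prod_form_cons; ring.
rewrite IH; congr (_ * _ + _); rewrite /prod_form !big_cat !big_cons /=.
by congr (_ * _); rewrite mulrCA.
Qed.

(** With [phi] zero on odd elements, the form vanishes on words with two adjacent odd letters, so
    the sign required there is harmless. *)
Lemma deriv_form0 phi psi u a b v : phi a = 0 -> phi b = 0 ->
  deriv_form phi psi (u ++ a :: b :: v) = 0.
Proof.
move=> pa pb; elim: u => [|x u IH] /=.
  by rewrite prod_form_cons pa pb !mul0r mulr0 addr0.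
by rewrite IH /prod_form big_cat big_cons /= pa mul0r !mulr0 addr0.
Qed.

Lemma even_functional w : homog false w -> w <> 0 ->
  exists phi : {scalar L}, phi w = 1 /\ forall x, homog true x -> phi x = 0.
Proof.
move=> hw w0; apply: separating_functional (homog_subspace _) _ => ow.
by apply: w0; apply: homog_direct.
Qed.

Lemma odd_functional (W : set L) y : is_subspace W -> homog true y -> ~ W y ->
  (forall x, W x -> homog true x) ->
  exists phi : {scalar L}, [/\ phi y = 1, forall x, W x -> phi x = 0 &
    forall x, homog false x -> phi x = 0].
Proof.
move=> sW hy Wy oW; have [phi [phiy phiW]] := separating_functional sW Wy.
pose f (x : L) := phi (odd_part x).
have flin : scalar f by move=> a u v; rewrite /f odd_part_linear linearP.
pose psi : {scalar L} := HB.pack f (GRing.isLinear.Build F L F *%R f flin).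
exists psi; split; rewrite /psi /= /f.
- by rewrite odd_part_odd.
- by move=> x Wx; rewrite odd_part_odd ?phiW //; apply: oW.
- by move=> x hx; rewrite odd_part_even // raddf0.
Qed.

(** If [phi w = 1] and [phi] kills odd elements, the power of [phi] is a supersymmetric form with
    value 1 on the word [w ... w]. *)
Lemma even_not_nilpotent w k : homog false w -> w <> 0 -> j w ^+ k <> 0.
Proof.
move=> hw w0; have [phi [phiw phi1]] := even_functional hw w0.
have gl := prod_form_multilinear phi.
have [i l a b u v ha hb _|Phi [Phik _ _]] := pbw0 (m := k) gl (multilinear_vanishes0 gl).
  rewrite /prod_form !big_cat !big_cons /=.
  case: i ha => ha; first by rewrite (phi1 a) // !(mul0r, mulr0).
  case: l hb => hb; first by rewrite (phi1 b) // !(mul0r, mulr0).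
  by rewrite mul1r (mulrCA (phi a)).
move=> wk; have := Phik (nseq k w) (size_nseq _ _).
rewrite /word /prod_form !prodr_nseq wk raddf0 phiw expr1n => /eqP.
by rewrite eq_sym oner_eq0.
Qed.

(** Take [phi] even with [phi w = 1], and [psi] odd with [psi y = 1] and [psi x = 0]. Then
    [deriv_form] is 1 on the word of [w^(k+1) y] and 0 on that of [w^k v x]. *)
Lemma clifford_neq0 w v x y k : homog false w -> homog false v ->
  homog true x -> homog true y -> w <> 0 -> (forall c, y <> c *: x) ->
  j w ^+ k * (j w * j y - j v * j x) <> 0.
Proof.
move=> hw hv hx hy w0 yx; have [phi [phiw phi1]] := even_functional hw w0.
pose W := [set z | exists c : F, z = c *: x].
have sW : is_subspace W.
  split; first by exists 0; rewrite scale0r.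
  by move=> a _ _ [c ->] [d ->]; exists (a * c + d); rewrite scalerDl scalerA.
have [|z [c ->]|psi [psiy psix psi0]] := odd_functional sW hy.
- by move=> [c /yx].
- by apply: subspaceZ; first exact: homog_subspace.
have gl := deriv_form_multilinear phi psi.
have [i l a b u z ha hb _|Phi [Phik _ _]] := pbw0 (m := k.+2) gl (multilinear_vanishes0 gl).
  case: (i =P true) => [it|/negP/negbTE ->]; last by rewrite mul1r deriv_form_swap.
  case: (l =P true) => [lt|/negP/negbTE ->]; last first.
    by rewrite andbF mul1r deriv_form_swap.
  move: ha hb; rewrite it lt => ha hb.
  by rewrite !deriv_form0 ?mulr0 //; apply: phi1.
move=> wk.
have wE a b : word j (nseq k w ++ [:: a; b]) = j w ^+ k * (j a * j b).
  by rewrite word_cat_cons2 /word prodr_nseq big_nil mulr1.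
have := Phik (nseq k w ++ [:: v; x]).
have := Phik (nseq k w ++ [:: w; y]).
rewrite !wE !size_cat size_nseq addn2 => /(_ (erefl _)) e1 /(_ (erefl _)) e2.
move: (congr1 Phi wk); rewrite mulrBr raddfB raddf0 /= e1 e2.
have pw : prod_form phi (nseq k w) = 1 by rewrite /prod_form prodr_nseq phiw expr1n.
have dE a b : deriv_form phi psi (nseq k w ++ [:: a; b]) = psi a * phi b + phi a * psi b.
  have psiw : psi w = 0 by apply: psi0.
  elim: k {wk wE e1 e2 Phik pw} => [|k IH] /=.
    by rewrite !prod_form_cons /prod_form big_nil !mulr1 mulr0 addr0.
  by rewrite psiw mul0r add0r phiw mul1r IH.
rewrite !dE psiy phiw (psix x) ?psi0 //; last by exists 1; rewrite scale1r.
by rewrite !(mul0r, mulr0) add0r mul1r addr0 subr0 => /eqP; rewrite oner_eq0.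
Qed.

End Functionals.

(** * Consequences of the Engel condition in degree zero and for odd squares *)

(** What the computations need of [env_in], isolated so that they apply equally to the quotient
    algebra of [odd_word_neq0]. *)
Definition env_map (F : fieldType) (L : lieSuperalgType F) (R : algType F)
    (j : L -> R) : Prop :=
  (forall a x y, j (a *: x + y) = a *: j x + j y) /\
  (forall i k x y, homog i x -> homog k y ->
     j x * j y = (-1) ^+ (i && k) *: (j y * j x) + j (brk x y)).

Section QuotientTest.
Variables (F : fieldType) (charF0 : [pchar F] =i pred0) (L : lieSuperalgType F).

Lemma env_in_map : env_map (@env_in F L).
Proof. by split; [exact: env_in_linear | move=> *; exact: env_in_rel]. Qed.

Variable K : set L.
Hypothesis oddK : forall x, K x -> homog true x.
Hypothesis brkKl : forall x y, K x -> K (brk x y).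
Hypothesis brkKr : forall x y, K y -> K (brk x y).

(** [R] is [U(L)] modulo the ideal generated by [K]. The determinant functional kills this ideal but
    not the word [zs], so the ideal is proper and the word survives in [R]. *)
Lemma odd_word_neq0 n m (phi : nat -> {scalar L}) zs :
  engel (env_alg L) n ->
  (forall i x, homog false x -> phi i x = 0) -> (forall i x, K x -> phi i x = 0) ->
  size zs = m -> \det (value_mx m phi zs) <> 0 ->
  exists (R : algType F) (j : L -> R),
    [/\ env_map j, forall x, K x -> j x = 0, engel R n & word j zs <> 0].
Proof.
move=> En phi0 phiK sz detz.
have [Phi [Phim PhiK]] := alternating_functional charF0 oddK brkKl brkKr m phi0 phiK.
pose S : set (env_alg L) := [set env_in x | x in K].
have SK u s v : S s -> Phi (word (@env_in F L) u * s * word (@env_in F L) v) = 0.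
  by move=> [x Kx <-]; rewrite -word_cat_cons PhiK.
have gen := @env_alg_ind F L.
have properS : proper_gen S.
  move=> S1; apply: detz; rewrite -Phim //.
  have := functional_ideal gen SK S1 1 (word (@env_in F L) zs).
  by rewrite !mul1r.
have [h hP] := alg_quot_functional properS gen SK.
pose j x := aq_proj properS (env_in x).
exists (alg_quot properS), j; split.
- split=> [a x y|i k x y hx hy].
    by rewrite /j env_in_linear aq_projD aq_projZ.
  by rewrite /j -2!(aq_projM properS) (env_in_rel hx hy) aq_projD aq_projZ.
- by move=> x Kx; apply: aq_proj_eq0; exists x.
- move=> u v; have [x ->] := aq_projP (properS := properS) u.
  have [y ->] := aq_projP (properS := properS) v.
  rewrite (_ : iter n _ _ = aq_proj properS (iter n (fun z => comm_br z y) x)).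
    by rewrite En aq_proj0.
  elim: n {En} => //= n ->.
  by rewrite /comm_br -2!(aq_projM properS) -aq_projB.
have -> : word j zs = aq_proj properS (word (@env_in F L) zs).
  rewrite /word; elim: (zs) => [|x s IH]; first by rewrite !big_nil aq_proj1.
  by rewrite !big_cons aq_projM -IH.
by move=> w0; apply: detz; rewrite -Phim // -hP w0 raddf0.
Qed.

End QuotientTest.

Section Bracket.
Variables (F : fieldType) (L : lieSuperalgType F).
Implicit Types (x y z a b : L).

Lemma brkDl x y z : brk (x + y) z = brk x z + brk y z.
Proof. by have := brk_linearl 1 x y z; rewrite !scale1r. Qed.

Lemma brkDr x y z : brk x (y + z) = brk x y + brk x z.
Proof. by have := brk_linearr 1 x y z; rewrite !scale1r. Qed.

Lemma brkZl c x z : brk (c *: x) z = c *: brk x z.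
Proof. by have := brk_linearl c x 0 z; rewrite brk0l !addr0. Qed.

Lemma brkZr c x z : brk x (c *: z) = c *: brk x z.
Proof. by have := brk_linearr c x z 0; rewrite brk0r !addr0. Qed.

Lemma brkNl x z : brk (- x) z = - brk x z.
Proof. by rewrite -scaleN1r brkZl scaleN1r. Qed.

Lemma brk_even_skew a x : homog false a -> brk a x = - brk x a.
Proof.
move=> ha; have [x0 [x1 [h0 h1 ->]]] := homog_sum x.
rewrite brkDl brkDr opprD (brk_skew _ _ _ _ ha h0) (brk_skew _ _ _ _ ha h1).
by rewrite !scale1r.
Qed.

Lemma brk_odd_sym x y : homog true x -> homog true y -> brk x y = brk y x.
Proof. by move=> hx hy; rewrite (brk_skew _ _ _ _ hx hy) scaleN1r opprK. Qed.

Lemma iter_brkZ a c k x :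
  iter k (fun z => brk z a) (c *: x) = c *: iter k (fun z => brk z a) x.
Proof. by elim: k => //= k ->; rewrite brkZl. Qed.

Lemma iter_brkD a k x y : iter k (fun z => brk z a) (x + y) =
  iter k (fun z => brk z a) x + iter k (fun z => brk z a) y.
Proof. by elim: k => //= k ->; rewrite brkDl. Qed.

Lemma iter_brk_homog a k i x : homog false a -> homog i x ->
  homog i (iter k (fun z => brk z a) x).
Proof.
move=> ha hx; elim: k => //= k IH.
by rewrite -(addbF i); apply: brk_homog.
Qed.

Lemma brk_spanP (H K' : set L) h k : H h -> K' k -> brk_span H K' (brk h k).
Proof. by move=> Hh Kk; apply: sub_lspan; exists h => //; exists k. Qed.

Lemma brk_span_eq0 (H K' : set L) :
  (forall h k, H h -> K' k -> brk h k = 0) -> brk_span H K' = [set 0].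
Proof. by move=> HK; apply: lspan_eq0 => _ [h Hh [k Kk <-]]; apply: HK. Qed.

Lemma brk_span0 (H K' : set L) h k :
  brk_span H K' = [set 0] -> H h -> K' k -> brk h k = 0.
Proof.
by move=> HK Hh Kk; have := brk_spanP Hh Kk; rewrite HK.
Qed.

End Bracket.

Lemma double_square_nilpotent (R : pzRingType) (z : R) n :
  z ^+ n = 0 -> (z * z + z * z) ^+ n = 0.
Proof.
move=> zn; rewrite -mulr2n -[_ *+ 2]mulr_natl exprMn_comm; last exact/commr_sym/commr_nat.
rewrite exprMn_comm // zn mulr0 mulr0 //.
Qed.

(** Applied to a nilpotent bracket operator [D], this supplies [z] with [D z] nonzero and
    [D (D z) = 0], as the product formula requires. *)
Lemma last_nonzero (T : zmodType) (f : T -> T) n x : iter n f (f x) = 0 -> f x <> 0 ->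
  exists k, f (iter k f x) <> 0 /\ f (f (iter k f x)) = 0.
Proof.
elim: n x => [|n IH] x //; rewrite iterSr => fn fx.
have [ffx|ffx] := pselect (f (f x) = 0); first by exists 0%N.
by have [k] := IH _ fn ffx; rewrite -iterSr; exists k.+1.
Qed.

Section EnvMap.
Variables (F : fieldType) (L : lieSuperalgType F) (R : algType F) (j : L -> R).
Hypothesis jmap : env_map j.

Lemma env_map_lin a x y : j (a *: x + y) = a *: j x + j y.
Proof. by case: jmap. Qed.

Lemma env_map0 : j 0 = 0.
Proof. by have := env_map_lin (-1) 0 0; rewrite scaler0 addr0 scaleN1r addNr. Qed.

Lemma env_mapD x y : j (x + y) = j x + j y.
Proof. by rewrite -[x in LHS]scale1r env_map_lin scale1r. Qed.

Lemma env_mapZ a x : j (a *: x) = a *: j x.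
Proof. by rewrite -[a *: x]addr0 env_map_lin env_map0 addr0. Qed.

Lemma env_map_even y a : homog false a -> comm_br (j y) (j a) = j (brk y a).
Proof.
move=> ha; case: jmap => _ jrel; have [y0 [y1 [h0 h1 ->]]] := homog_sum y.
rewrite brkDl !env_mapD /comm_br mulrDl mulrDr.
rewrite (jrel _ _ _ _ h0 ha) (jrel _ _ _ _ h1 ha) !scale1r opprD addrACA.
by rewrite [j a * _ + _]addrC addrK [X in _ + (X - _)]addrC addrK.
Qed.

Lemma env_map_iter k y a : homog false a ->
  iter k (fun z => comm_br z (j a)) (j y) = j (iter k (fun z => brk z a) y).
Proof. by move=> ha; elim: k => //= k ->; rewrite env_map_even. Qed.

Lemma env_map_comm x a : homog false a -> j (brk x a) = 0 -> GRing.comm (j a) (j x).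
Proof.
move=> ha xa; have := env_map_even x ha; rewrite xa => /eqP.
by rewrite subr_eq0 => /eqP.
Qed.

Lemma env_map_odd x y : homog true x -> homog true y ->
  j x * j y + j y * j x = j (brk x y).
Proof.
case: jmap => _ jrel hx hy; rewrite (jrel _ _ _ _ hx hy) scaleN1r.
by rewrite addrAC addNr add0r.
Qed.

Lemma env_map_anticomm x y : homog true x -> homog true y -> brk x y = 0 ->
  anticomm (j x) (j y).
Proof.
move=> hx hy xy; apply/eqP; rewrite -addr_eq0; apply/eqP.
by rewrite env_map_odd // xy env_map0.
Qed.

End EnvMap.

Section EngelForward.
Variables (F : fieldType) (charF0 : [pchar F] =i pred0) (L : lieSuperalgType F).
Variable (n : nat).
Hypothesis En : engel (env_alg L) n.
Implicit Types (x y z a b w v : L).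
Local Notation j := (@env_in F L).
Local Notation jmap := (@env_in_map F L).

Lemma ad_even_nilpotent a y : homog false a -> iter n (fun z => brk z a) y = 0.
Proof. by move=> ha; apply: (env_in_inj charF0); rewrite -(env_map_iter jmap) // En. Qed.

Lemma ad_last a y : homog false a -> brk y a <> 0 ->
  exists k, let z := iter k (fun z => brk z a) y in
    brk z a <> 0 /\ brk (brk z a) a = 0.
Proof.
move=> ha ya; apply: (@last_nonzero _ (fun z => brk z a) n) => //.
exact: ad_even_nilpotent.
Qed.

Lemma ad_image_nilpotent a y : homog false a -> brk (brk y a) a = 0 ->
  j (brk y a) ^+ n = 0.
Proof.
move=> ha yaa; rewrite -(env_map_even jmap) //.
rewrite -(prodr_nseq n (j y) (fun u => comm_br u (j a))).
apply: (engel_prod charF0 En); first by rewrite size_nseq.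
move=> z /nseqP[-> _].
by rewrite !(env_map_even jmap) // yaa (env_map0 jmap).
Qed.

(** The last nonzero bracket [(z,a)] is even and has a nilpotent image in [U(L)], contrary to
    [even_not_nilpotent]. *)
Lemma even_part_abelian a b : homog false a -> homog false b -> brk b a = 0.
Proof.
move=> ha hb; have [//|ba] := pselect (brk b a = 0).
have [k [za zaa]] := ad_last ha ba.
have hz : homog false (iter k (fun z => brk z a) b) by apply: iter_brk_homog.
have := ad_image_nilpotent ha zaa.
by move=> /(even_not_nilpotent charF0 (brk_homog _ _ _ _ hz ha)) [].
Qed.

Section OddSquare.
Variable x : L.
Hypotheses (hx : homog true x) (xx : brk x x <> 0).
Let w := brk x x.

Let hw : homog false w.
Proof. exact: (brk_homog _ _ _ _ hx hx). Qed.

Lemma commuting_odd_dependent y : homog true y -> brk y w = 0 -> exists c, y = c *: x.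
Proof.
move=> hy yw; have [//|yx] := pselect (exists c, y = c *: x).
pose v := brk x y.
have hv : homog false v by apply: (brk_homog _ _ _ _ hx hy).
(* The Jacobi identity for [x], [x], [y] reads [(x,v) = (w,y) - (x,v)], and [(w,y) = 0]. *)
have vx : brk x v = 0.
  have := brk_jacobi _ _ _ _ _ _ hx hx hy; rewrite -/v -/w scaleN1r.
  rewrite (brk_even_skew _ hw) yw oppr0 add0r => /eqP.
  by rewrite -subr_eq0 opprK => /eqP /(twice_eq0 charF0).
have [] := clifford_neq0 charF0 (k := n) hw hv hx hy xx.
  by move=> c yc; apply: yx; exists c.
apply: (engel_clifford charF0 En).
- by rewrite (env_map_odd jmap).
- by rewrite (env_map_odd jmap).
- by apply: (env_map_comm jmap) => //; rewrite yw (env_map0 jmap).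
- by apply: (env_map_comm jmap) => //; rewrite vx (env_map0 jmap).
Qed.

(** The last nonzero bracket [(t,w)] commutes with [w], hence equals [c x]. Being odd with nilpotent
    image, it has square bracket zero; but that square is [c^2 w], so [c = 0]. *)
Lemma square_central y : homog true y -> brk y w = 0.
Proof.
move=> hy; have [//|yw] := pselect (brk y w = 0).
have [k [zw zww]] := ad_last hw yw.
pose t := iter k (fun z => brk z w) y.
have ht : homog true (brk t w).
  by apply: (brk_homog _ _ _ _ (iter_brk_homog _ hw hy) hw).
have [c tc] := commuting_odd_dependent ht zww.
have tt : brk (brk t w) (brk t w) = 0.
  have [//|tt] := pselect (brk (brk t w) (brk t w) = 0).
  have [] := even_not_nilpotent charF0 (brk_homog _ _ _ _ ht ht) tt (k := n).
  rewrite -(env_map_odd jmap) //; apply: double_square_nilpotent.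
  exact: ad_image_nilpotent.
case: zw; rewrite -/t tc; move: tt; rewrite tc brkZl brkZr scalerA => /eqP.
rewrite scaler_eq0 mulf_eq0 orbb => /orP[/eqP ->|/eqP]; last by move/xx.
by rewrite scale0r.
Qed.

Lemma odd_part_line y : homog true y -> exists c, y = c *: x.
Proof. by move=> hy; apply: commuting_odd_dependent (square_central hy). Qed.

(** With [(a,x) = d x] the Jacobi identity gives [(a,w) = 2 d w], while [(a,w) = 0] as [L_0] is
    abelian. *)
Lemma even_odd_trivial a y : homog false a -> homog true y -> brk a y = 0.
Proof.
move=> ha hy; have [c ->] := odd_part_line hy; rewrite brkZr.
have [d axd] := odd_part_line (brk_homog _ _ _ _ ha hx : homog true _).
have := brk_jacobi _ _ _ _ _ _ ha hx hx; rewrite -/w scale1r axd brkZl brkZr -/w.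
rewrite (even_part_abelian hw ha) => /esym/(twice_eq0 charF0)/eqP.
rewrite scaler_eq0 => /orP[/eqP ->|/eqP/xx //].
by rewrite scale0r scaler0.
Qed.

End OddSquare.
End EngelForward.

(** * Enveloping algebras with commuting homogeneous parts *)

Section Layers.
Variables (F : fieldType) (charF0 : [pchar F] =i pred0) (L : lieSuperalgType F).
Hypothesis even0 : forall a b : L, homog false a -> homog false b -> brk a b = 0.
Hypothesis odd0 : forall x y : L, homog true x -> homog true y -> brk x y = 0.
Implicit Types (x y z a b : L) (s : seq L).

(** Under the hypotheses of this section these are ideals, and from index 1 on they are the terms of
    the lower central series. *)
Fixpoint ad_layer k : set L :=
  if k is k'.+1 then lspan [set brk y a | y in ad_layer k' & a in homog false]
  else homog true.

Lemma ad_layer_subspace k : is_subspace (ad_layer k).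
Proof. by case: k => [|k]; [exact: homog_subspace | exact: lspan_subspace]. Qed.

Lemma ad_layer_brk k y a : ad_layer k y -> homog false a -> ad_layer k.+1 (brk y a).
Proof. by move=> ky ha; apply: sub_lspan; exists y => //; exists a. Qed.

Lemma ad_layerS k : ad_layer k.+1 `<=` ad_layer k.
Proof.
elim: k => [|k IH]; apply: lspan_min; try exact: ad_layer_subspace.
  by move=> _ [y hy [a ha <-]]; apply: (brk_homog _ _ _ _ hy ha).
by move=> _ [y ky [a ha <-]]; apply: ad_layer_brk => //; apply: IH.
Qed.

Lemma ad_layer_odd k : ad_layer k `<=` homog true.
Proof. by elim: k => [|k IH] x //= /ad_layerS /IH. Qed.

Lemma ad_layer_idealr k x y : ad_layer k x -> ad_layer k (brk x y).
Proof.
move=> kx; have [y0 [y1 [h0 h1 ->]]] := homog_sum y.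
rewrite brkDr (odd0 (ad_layer_odd kx) h1) addr0.
by apply: ad_layerS; apply: ad_layer_brk.
Qed.

Lemma ad_layer_ideall k x y : ad_layer k y -> ad_layer k (brk x y).
Proof.
move=> ky; have [x0 [x1 [h0 h1 ->]]] := homog_sum x.
rewrite brkDl (odd0 h1 (ad_layer_odd ky)) addr0 brk_even_skew //.
by apply: subspaceN; [exact: ad_layer_subspace | exact: ad_layer_idealr].
Qed.

Lemma brk_even_comm i y a b : homog i y -> homog false a -> homog false b ->
  brk (brk y a) b = brk (brk y b) a.
Proof.
move=> hy ha hb; have := brk_jacobi _ _ _ _ _ _ hy ha hb.
rewrite (even0 ha hb) brk0r andbF scale1r (brk_even_skew _ ha) => /esym/eqP.
by rewrite subr_eq0 => /eqP.
Qed.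

(** Expanding a power of [ad (a + t b)] in [t]; the coefficient of [t] is what polarization
    extracts. *)
Lemma polarization_poly (phi : {scalar L}) a b m y :
  homog false a -> homog false b -> homog true y ->
  exists p : {poly F},
    [/\ forall t, p.[t] = phi (iter m (fun z => brk z (a + t *: b)) y),
        p`_0 = phi (iter m (fun z => brk z a) y) &
        p`_1 = m%:R * phi (iter m.-1 (fun z => brk z a) (brk y b))].
Proof.
move=> ha hb; elim: m y => [|m IH] y hy.
  exists (phi y)%:P; split=> [t||]; rewrite ?hornerC ?coefC //=.
  by rewrite mul0r.
have [p1 [e1 c01 c11]] := IH _ (brk_homog _ _ _ _ hy ha).
have [p2 [e2 c02 c12]] := IH _ (brk_homog _ _ _ _ hy hb).
(* The innermost bracket with [a + t b] splits: [p1] continues from [(y,a)] and [p2] from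
   [(y,b)]. *)
exists (p1 + 'X * p2); split=> [t||].
- rewrite hornerD hornerM hornerX e1 e2 iterSr brkDr brkZr iter_brkD iter_brkZ.
  by rewrite raddfD /= scalarZ.
- by rewrite coefD coefXM addr0 c01 iterSr.
- rewrite coefD coefXM /= c11 c02 (brk_even_comm hy ha hb).
  case: m {IH e1 e2 c01 c11 c02 c12} => [|m]; first by rewrite mul0r add0r mul1r.
  by rewrite [m.+1.-1]/= -iterSr [in RHS]mulrS mulrDl mul1r addrC.
Qed.

Lemma iter_brk_polarize m a b y :
  homog false a -> homog false b -> homog true y ->
  (forall c, homog false c -> iter m.+1 (fun z => brk z c) y = 0) ->
  iter m (fun z => brk z a) (brk y b) = 0.
Proof.
move=> ha hb hy nil; set z := iter _ _ _.
have [//|z0] := pselect (z = 0).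
have [phi [phiz _]] := separating_functional (subspace_set0 L) z0.
have [p [pt _ p1]] := polarization_poly phi m.+1 ha hb hy.
have p0 : p = 0.
  apply: (poly_eq0_horner charF0) => t; rewrite pt nil ?raddf0 //.
  have [_] := homog_subspace (s := L) false => lin.
  by rewrite addrC; apply: lin.
move: p1; rewrite p0 coef0 /= -/z phiz mulr1 => /esym/eqP.
by rewrite (negbTE (natr_neq0 charF0 m)).
Qed.

(** Full polarization, one letter at a time: after a bracket with [b], the set [X] becomes [(X,b)]
    and the exponent drops by one. *)
Lemma foldl_brk_eq0 m (X : set L) : X `<=` homog true ->
  (forall a y, homog false a -> X y -> iter m (fun z => brk z a) y = 0) ->
  forall s y, size s = m -> (forall a, a \in s -> homog false a) -> X y ->
  foldl brk y s = 0.
Proof.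
elim: m X => [|m IH] X oX nil [|b s] y //= ss hs Xy.
  by apply: (nil 0) => //; apply: subspace0; apply: homog_subspace.
have hb : homog false b by apply: hs; rewrite inE eqxx.
apply: (IH [set brk u b | u in X]) => //.
- by move=> _ [u Xu <-]; apply: (brk_homog _ _ _ _ (oX _ Xu) hb).
- move=> a _ ha [u Xu <-]; apply: iter_brk_polarize => //; first exact: oX.
  by move=> c hc; apply: nil.
- by case: ss.
- by move=> a sa; apply: hs; rewrite inE sa orbT.
- by exists y.
Qed.

Lemma ad_layer_nil n :
  (forall a y, homog false a -> homog true y -> iter n (fun z => brk z a) y = 0) ->
  ad_layer n `<=` [set 0].
Proof.
move=> nil.
(* [Z m] consists of the elements killed by any [m] successive brackets with even elements. Passing
   to the next layer uses up one bracket, so layer [k] lies in [Z (n - k)]. *)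
pose Z m := [set y | forall s, size s = m ->
  (forall a, a \in s -> homog false a) -> foldl brk y s = 0].
have sZ m : is_subspace (Z m).
  have fl s c u v : foldl brk (c *: u + v) s = c *: foldl brk u s + foldl brk v s.
    by elim: s u v => //= a s IH u v; rewrite brk_linearl IH.
  split=> [s _ _|c u v Zu Zv s ss hs]; last by rewrite fl Zu // Zv // scaler0 addr0.
  by have := fl s (-1) 0 0; rewrite scaler0 addr0 scaleN1r addNr.
suff ZP k m : (k + m)%N = n -> ad_layer k `<=` Z m.
  by move=> y /(ZP n 0 (addn0 n)) Zy; apply: (Zy [::]).
elim: k m => [|k IH] m km /=.
  move=> y hy s ss hs; have sn : size s = n by rewrite ss -km.
  exact: (foldl_brk_eq0 (X := homog true) _ nil sn hs hy).
apply: lspan_min => // _ [y ky [a ha <-]] s ss hs.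
apply: (IH m.+1 _ y ky (a :: s)); [by rewrite addnS | by rewrite /= ss|].
by move=> c; rewrite inE => /orP[/eqP ->|/hs].
Qed.

Lemma lower_central_layer k : lower_central k.+1 `<=` ad_layer k.+1.
Proof.
elim: k => [|k IH]; apply: lspan_min; try exact: ad_layer_subspace.
  move=> _ [x _ [y _ <-]].
  have [x0 [x1 [hx0 hx1 ->]]] := homog_sum x.
  have [y0 [y1 [hy0 hy1 ->]]] := homog_sum y.
  rewrite brkDl !brkDr (even0 hx0 hy0) (odd0 hx1 hy1) add0r addr0.
  apply: (subspaceD (ad_layer_subspace 1)).
    rewrite brk_even_skew //; apply: (subspaceN (ad_layer_subspace 1)).
    exact: (@ad_layer_brk 0).
  exact: (@ad_layer_brk 0).
move=> _ [x /IH kx [y _ <-]].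
have [y0 [y1 [hy0 hy1 ->]]] := homog_sum y.
by rewrite brkDr (odd0 (ad_layer_odd kx) hy1) addr0; apply: ad_layer_brk.
Qed.

(** * Finite dimension of a layer modulo the next one *)

Section FiniteLayer.
Variables (n k : nat).
Hypothesis En : engel (env_alg L) n.
Local Notation K := (ad_layer k.+2).

Let sK : is_subspace K := ad_layer_subspace k.+2.
Let oddK := @ad_layer_odd k.+2.
Let brkKl := @ad_layer_idealr k.+2.
Let brkKr := @ad_layer_ideall k.+2.

Definition cons_fun (T : Type) (x : T) (f : nat -> T) i : T :=
  if i is i'.+1 then f i' else x.

Lemma det_value_mx_cons m (psi : {scalar L}) (phi : nat -> {scalar L}) z zs : size zs = m ->
  psi z = 1 -> (forall x, x \in zs -> psi x = 0) ->
  \det (value_mx m.+1 (cons_fun psi phi) (z :: zs)) = \det (value_mx m phi zs).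
Proof.
move=> sz psiz psi0; rewrite (expand_det_col _ ord0) big_ord_recl /= big1 => [|i _].
  rewrite mxE /= psiz mul1r addr0 /cofactor expr0 mul1r; congr (\det _).
  by apply/matrixP => i l; rewrite !mxE.
by rewrite !mxE /= psi0 ?mul0r // add0n mem_nth ?sz.
Qed.

Lemma mod_span_odd zs : (forall z, z \in zs -> homog true z) ->
  mod_span K zs `<=` homog true.
Proof.
by move=> hz; apply: mod_span_min => //; apply: homog_subspace.
Qed.

(** A functional that is 1 on [z] and 0 on [K] and [zs] makes the new column a unit vector, so the
    determinant witnessing independence modulo [K] is unchanged. *)
Lemma extend_test (phi : nat -> {scalar L}) zs z : homog true z ->
  (forall x, x \in zs -> homog true x) -> ~ mod_span K zs z ->
  (forall i x, homog false x -> phi i x = 0) -> (forall i x, K x -> phi i x = 0) ->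
  exists phi' : nat -> {scalar L}, [/\ forall i x, homog false x -> phi' i x = 0,
    forall i x, K x -> phi' i x = 0 &
    \det (value_mx (size zs).+1 phi' (z :: zs)) = \det (value_mx (size zs) phi zs)].
Proof.
move=> hz hzs nz phi0 phiK.
have [psi [psiz psizs psi0]] :=
  odd_functional (mod_span_subspace _ _) hz nz (mod_span_odd hzs).
exists (cons_fun psi phi); split.
- by case.
- by case=> // x Kx; apply: psizs; apply: mod_spanW.
- by apply: det_value_mx_cons => // x zsx; apply: psizs; apply: mod_span_mem.
Qed.

Lemma zero_functional : exists phi : {scalar L}, forall x, phi x = 0.
Proof.
pose f (x : L) : F := 0.
have flin : scalar f by move=> a x y; rewrite /f mulr0 addr0.
pose phi : {scalar L} := HB.pack f (GRing.isLinear.Build F L F *%R f flin).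
by exists phi.
Qed.

Lemma independent_family (G : set L) m : G `<=` homog true ->
  (forall zs, exists z, G z /\ ~ mod_span K zs z) ->
  exists zs (phi : nat -> {scalar L}), [/\ size zs = m, forall z, z \in zs -> G z,
    forall i x, homog false x -> phi i x = 0, forall i x, K x -> phi i x = 0 &
    \det (value_mx m phi zs) = 1].
Proof.
move=> oG inf; elim: m => [|m [zs [phi [sz Gz phi0 phiK dz]]]].
  have [phi phi0] := zero_functional.
  by exists [::], (fun=> phi); split=> //; rewrite det_mx00.
have [z [Gz' nz]] := inf zs.
have [|x zsx|phi' [phi'0 phi'K dz']] := extend_test _ _ nz phi0 phiK.
- exact: oG.
- by apply/oG/Gz.
exists (z :: zs), phi'; split=> //=; first by rewrite sz.
  by move=> x; rewrite inE => /orP[/eqP ->|/Gz].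
by rewrite sz in dz'; rewrite dz' dz.
Qed.

(** The map [y |-> (y,a)] from layer [k] to layer [k.+1] modulo [K] has rank at least [m]. The
    determinant is the form of independence that [odd_word_neq0] accepts. *)
Definition rank_ge a m : Prop := exists ys (phi : nat -> {scalar L}),
  [/\ size ys = m, forall y, y \in ys -> ad_layer k y,
      forall i x, homog false x -> phi i x = 0, forall i x, K x -> phi i x = 0 &
      \det (value_mx m phi [seq brk y a | y <- ys]) <> 0].

(** Modulo [K] the double brackets [((y,a),a)] vanish, so for [n <= m] the Engel condition kills the
    product of the [(y,a)], which a nonzero determinant keeps nonzero. *)
Lemma rank_lt a m : homog false a -> rank_ge a m -> (m < n)%N.
Proof.
move=> ha [ys [phi [sy ky phi0 phiK dz]]]; rewrite ltnNge; apply/negP => nm.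
have szs : size [seq brk y a | y <- ys] = m by rewrite size_map.
have [R [j [jmap jK EnR []]]] :=
  odd_word_neq0 charF0 oddK brkKl brkKr En phi0 phiK szs dz.
have := engel_prod charF0 EnR (a := j a) (s := [seq j y | y <- ys]).
rewrite size_map sy => /(_ nm) <-; last first.
  move=> _ /mapP[y /ky kyy ->]; rewrite !(env_map_even jmap) //.
  by apply: jK; do 2 apply: ad_layer_brk => //.
rewrite /word !big_map; apply: eq_bigr => y _.
by rewrite (env_map_even jmap).
Qed.

Lemma word_pairs (R : algType F) (j : L -> R) N zs : size zs = N.*2.+1 ->
  word j zs = \prod_(i < N) (j zs`_(i.*2) * j zs`_(i.*2.+1)) * j zs`_(N.*2).
Proof.
elim: N zs => [|N IH] [|a [|b zs]] //=.
  by rewrite /word big_seq1 big_ord0 mul1r.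
move=> [sz]; rewrite big_ord_recl /= -mulrA -mulrA /word !big_cons; congr (_ * (_ * _)).
by rewrite -/(word j zs) IH.
Qed.

(** Otherwise there are [2 (n + 1) + 1] brackets [(a_i,y)] independent modulo [K]. Taken alternately
    as [Z i] and [S i], the last one as [z0], they have product zero by [engel_zeta], against
    [odd_word_neq0]. *)
Lemma even_orbit_finite y : ad_layer k y ->
  exists s, forall a, homog false a -> mod_span K s (brk a y).
Proof.
move=> ky; have [//|inf] := pselect (exists s, forall a, homog false a ->
  mod_span K s (brk a y)).
pose G := [set brk a y | a in homog false].
have hy : homog true y := ad_layer_odd ky.
have oG : G `<=` homog true by move=> _ [a ha <-]; apply: (brk_homog _ _ _ _ ha hy).
have [|zs [phi [sz Gz phi0 phiK dz]]] := independent_family n.+1.*2.+1 oG.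
  move=> zs; have [//|no] := pselect (exists z, G z /\ ~ mod_span K zs z).
  case: inf; exists zs => a ha.
  have [//|nz] := pselect (mod_span K zs (brk a y)).
  by case: no; exists (brk a y); split=> //; exists a.
have [|R [j [jmap jK EnR []]]] := odd_word_neq0 charF0 oddK brkKl brkKr En phi0 phiK sz.
  by rewrite dz => /eqP; rewrite oner_eq0.
have Gnth i : exists a, homog false a /\ brk a y = zs`_i.
  have [lt|ge] := ltnP i (size zs).
    by have [a ha <-] := Gz _ (mem_nth 0 lt); exists a.
  (* Beyond the list the default 0 of [nth] is the bracket of 0 with [y], so the families are
     defined for all indices as [engel_zeta] wants. *)
  exists 0; rewrite nth_default // brk0l; split=> //.
  exact: subspace0 (homog_subspace _).
have [f fP] := choice Gnth.
have fh i : homog false (f i) by case: (fP i).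
have fE i : brk (f i) y = zs`_i by case: (fP i).
have hz i : homog true zs`_i by rewrite -fE; apply: oG; exists (f i).
have kz i : ad_layer k.+1 zs`_i.
  rewrite -fE brk_even_skew //; apply: (subspaceN (ad_layer_subspace k.+1)).
  exact: ad_layer_brk.
have ff i l : GRing.comm (j (f i)) (j (f l)).
  by apply: (env_map_comm jmap) => //; rewrite even0 // (env_map0 jmap).
have fz i l : GRing.comm (j (f i)) (j zs`_l).
  by apply: (env_map_comm jmap) => //; apply: jK; apply: ad_layer_brk.
have fy i : j (f i) * j y = j y * j (f i) + j zs`_i.
  by case: jmap => _ jrel; rewrite (jrel _ _ _ _ (fh i) hy) scale1r fE.
have anti x z : homog true x -> homog true z -> anticomm (j x) (j z).
  by move=> hx hz'; apply: (env_map_anticomm jmap) => //; apply: odd0.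
rewrite (word_pairs j sz).
apply: (@engel_zeta _ charF0 _ n (fun i => j (f i.*2)) (fun i => j zs`_i.*2.+1)
    (fun i => j zs`_i.*2) (j (f n.+1.*2)) (j y)) => // *;
  by [exact: ff | exact: fz | exact: fy | exact: anti].
Qed.

Lemma brk_sum (I : Type) (r : seq I) (c : I -> F) (y : I -> L) a :
  brk (\sum_(i <- r) c i *: y i) a = \sum_(i <- r) c i *: brk (y i) a.
Proof.
elim: r => [|i r IH]; first by rewrite !big_nil brk0l.
by rewrite !big_cons brk_linearl IH.
Qed.

(* With [a] of maximal rank and [brk y a] in [K], a direction [brk y b] outside
   of the image of [a] would give [a + t *: b] a larger rank: its value at
   [t^-1 *: y] is [brk y b] modulo [K]. *)
Lemma layer_finite_mod : exists s, ad_layer k.+1 `<=` mod_span K s.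
Proof.
have [r [a [ha [ys [phi [sy ky phi0 phiK dz]]] rmax]]] : exists r a,
    [/\ homog false a, rank_ge a r & forall b, homog false b -> ~ rank_ge b r.+1].
  pose P m := `[< exists2 a, homog false a & rank_ge a m >].
  have P0 : exists m, P m.
    exists 0%N; apply/asboolP; exists 0; first exact: subspace0 (homog_subspace _).
    have [phi phi0] := zero_functional.
    exists [::], (fun=> phi); split=> //; rewrite det_mx00.
    by apply/eqP; rewrite oner_eq0.
  have Pmax m : P m -> (m <= n)%N.
    by move=> /asboolP[a ha /(rank_lt ha) /ltnW].
  have [r /asboolP[a ha ra] rmax] := ex_maxnP P0 Pmax.
  exists r, a; split=> // b hb rb.
  suff /rmax : P r.+1 by rewrite ltnn.
  by apply/asboolP; exists b.
pose zs := [seq brk y a | y <- ys].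
have szs : size zs = r by rewrite size_map.
have hzs x : x \in zs -> homog true x.
  by move=> /mapP[y /ky kyy ->]; apply: (brk_homog _ _ _ _ (ad_layer_odd kyy) ha).
(* Otherwise [y] could be added to [ys], giving [a] the rank [r.+1]. *)
have image y : ad_layer k y -> mod_span K zs (brk y a).
  move=> kyy; have [//|nz] := pselect (mod_span K zs (brk y a)).
  have hya : homog true (brk y a) by apply: (brk_homog _ _ _ _ (ad_layer_odd kyy) ha).
  have [phi' [phi'0 phi'K dz']] := extend_test hya hzs nz phi0 phiK.
  case: (rmax a ha); exists (y :: ys), phi'; split=> //=; first by rewrite sy.
    by move=> x; rewrite inE => /orP[/eqP ->|/ky].
  by rewrite szs in dz'; rewrite dz'.
have kernel y b : ad_layer k y -> homog false b -> K (brk y a) -> mod_span K zs (brk y b).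
  move=> kyy hb Kya; have [//|nz] := pselect (mod_span K zs (brk y b)).
  have hyb : homog true (brk y b) by apply: (brk_homog _ _ _ _ (ad_layer_odd kyy) hb).
  have [phi' [phi'0 phi'K dz']] := extend_test hyb hzs nz phi0 phiK.
  rewrite szs in dz'.
  (* Row 0 of [u + t v] is the constant [(y,b)], since [v] starts with 0; the other rows are
     [(y_i, a + t b)]. At [t = 0] the determinant is the nonzero one of [dz']. *)
  pose u := brk y b :: zs; pose v := 0 :: [seq brk y b | y <- ys].
  pose M : 'M[{poly F}]_r.+1 :=
    \matrix_(i, l) ((phi' l u`_i)%:P + (phi' l v`_i) *: 'X).
  have Mt t : (\det M).[t] = \det (\matrix_(i, l) phi' l (u`_i + t *: v`_i) : 'M_r.+1).
    rewrite -[LHS]/(horner_eval t (\det M)) -det_map_mx; congr (\det _).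
    apply/matrixP => i l; rewrite !mxE /= /horner_eval hornerD hornerC hornerZ hornerX.
    by rewrite raddfD /= scalarZ mulrC.
  (* The factor [t] excludes [t = 0], as the witness below is [t^-1 *: y]. *)
  have [t tM] : exists t, t * (\det M).[t] != 0.
    have [//|no] := pselect (exists t, t * (\det M).[t] != 0).
    have p0 : 'X * \det M = 0.
      apply: (poly_eq0_horner charF0) => t; rewrite hornerM hornerX.
      by apply/eqP/negPn/negP => tM; apply: no; exists t.
    move: p0 => /eqP; rewrite mulf_eq0 polyX_eq0 /= => /eqP M0.
    case: dz; rewrite -dz' (_ : value_mx _ _ _ = \matrix_(i, l) phi' l (u`_i + 0 *: v`_i)).
      by rewrite -Mt M0 horner0.
    by apply/matrixP => i l; rewrite !mxE scale0r addr0.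
  move: tM; rewrite mulf_eq0 negb_or => /andP[t0 tM].
  have hab : homog false (a + t *: b).
    by rewrite addrC; case: (homog_subspace (s := L) false) => _; apply.
  case: (rmax _ hab); exists (t^-1 *: y :: ys), phi'; split=> //=.
  - by rewrite sy.
  - move=> x; rewrite inE => /orP[/eqP ->|/ky //].
    by apply: subspaceZ => //; apply: ad_layer_subspace.
  move=> d0; move/eqP: tM; apply; rewrite Mt -[RHS]d0; congr (\det _).
  apply/matrixP => i l; rewrite !mxE; case: (i : nat) (ltn_ord i) => [|i'] /= lt.
    rewrite scaler0 addr0 brkZl brkDr brkZr scalerDr scalerA mulVf // scale1r.
    by rewrite raddfD /= scalarZ (phi'K _ _ Kya) mulr0 add0r.
  rewrite /zs !(nth_map 0) ?sy //; first by rewrite brkDr brkZr.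
have orbits y : exists s, ad_layer k y ->
    forall b, homog false b -> mod_span K s (brk b y).
  have [kyy|nk] := pselect (ad_layer k y); last by exists [::].
  by have [s sP] := even_orbit_finite kyy; exists s.
have [S SP] := choice orbits.
exists (zs ++ flatten [seq S y | y <- ys]).
apply: lspan_min; first exact: mod_span_subspace.
move=> _ [y kyy [b hb <-]].
have [c Kc] := mod_spanP sK (image _ kyy).
rewrite szs in c Kc.
(* The combination is chosen so that [(y',a)] lies in [K] and [kernel] applies to [y']; the
   subtracted [ys] are covered by their finite orbits [S]. *)
pose y' := y - \sum_(i < r) c i *: ys`_i.
have sumk : ad_layer k (\sum_(i < r) c i *: ys`_i).
  apply: subspace_sum => [|i]; first exact: ad_layer_subspace.
  apply: subspaceZ; first exact: ad_layer_subspace.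
  by apply: ky; apply: mem_nth; rewrite sy.
have ky' : ad_layer k y' by apply: subspaceB => //; apply: ad_layer_subspace.
have Ky' : K (brk y' a).
  rewrite /y' brkDl brkNl brk_sum; move: Kc; congr (K (_ - _)).
  by apply: eq_bigr => i _; rewrite /zs (nth_map 0) // sy.
rewrite -[y](subrK (\sum_(i < r) c i *: ys`_i)) -/y' brkDl brk_sum.
apply: (subspaceD (mod_span_subspace _ _)).
  apply: mod_span_sub (kernel _ _ ky' hb Ky').
  by move=> x; rewrite mem_cat => ->.
apply: (subspace_sum _ (mod_span_subspace _ _)) => i.
apply: (subspaceZ _ (mod_span_subspace _ _)).
have ysi : ys`_i \in ys by apply: mem_nth; rewrite sy.
rewrite -[brk _ b]opprK -brk_even_skew //.
apply: (subspaceN (mod_span_subspace _ _)).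
apply: mod_span_sub (SP _ (ky _ ysi) _ hb) => x Sx.
rewrite mem_cat; apply/orP; right; apply/flattenP; exists (S ys`_i) => //.
exact: map_f.
Qed.

End FiniteLayer.

(** Layer [n] is zero, so going upwards one layer at a time only finitely many finite lists have to
    be joined. *)
Lemma layer_finite n k : engel (env_alg L) n ->
  exists s, ad_layer k.+1 `<=` mod_span [set 0] s.
Proof.
move=> En; have nil : ad_layer n `<=` [set 0].
  by apply: ad_layer_nil => a y ha _; apply: (ad_even_nilpotent charF0 En).
have deep m : ad_layer (m + n) `<=` [set 0].
  by elim: m => [|m IH] //= x /ad_layerS /IH.
suff down d m : (m + d)%N = n -> exists s, ad_layer m.+1 `<=` mod_span [set 0] s.
  have [le|lt] := leqP k n; first by apply: (down (n - k)%N); rewrite subnKC.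
  exists [::] => x kx; apply: mod_spanW.
  by apply: (deep (k.+1 - n)%N); rewrite subnK // ltnW // ltnW.
elim: d m => [|d IH] m.
  rewrite addn0 => ->; exists [::] => x /ad_layerS /nil x0.
  exact: mod_spanW.
rewrite addnS -addSn => /IH[s sP].
have [t tP] := layer_finite_mod m En.
exists (s ++ t) => x /tP.
apply: mod_span_min => [|y /sP|y ty]; first exact: mod_span_subspace.
  by apply: mod_span_sub => z; rewrite mem_cat => ->.
by apply: mod_span_mem; rewrite mem_cat ty orbT.
Qed.

End Layers.

(** * Lie nilpotency *)

Section Generation.
Variables (F : fieldType) (R : algType F) (I : Type) (gen : I -> R).
Hypothesis genR : linearly_generates gen.

Lemma generators_left (P : R -> Prop) :
  P 0 -> (forall a x y, P x -> P y -> P (a *: x + y)) -> P 1 ->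
  (forall i x, P x -> P (gen i * x)) -> forall x, P x.
Proof.
move=> P0 Pl P1 Pg; apply: genR => // w; rewrite /word.
by elim: w => [|i w IH]; rewrite ?big_nil // big_cons; apply: Pg.
Qed.

Lemma generators_comm : (forall i k, GRing.comm (gen i) (gen k)) ->
  forall x y : R, GRing.comm x y.
Proof.
have lin (u : R) a (x y : R) : GRing.comm u x -> GRing.comm u y -> GRing.comm u (a *: x + y).
  by move=> ux uy; apply: commrD => //; rewrite /GRing.comm -scalerAr -scalerAl ux.
move=> gg; have gx i x : GRing.comm (gen i) x.
  apply: generators_left x => [|a x y||k x ix].
  - exact: commr0.
  - exact: lin.
  - exact: commr1.
  - by apply: commrM.
move=> x; apply: generators_left => [|a y z||i y xy].
- exact: commr0.
- exact: lin.
- exact: commr1.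
- by apply: commrM => //; apply/commr_sym.
Qed.

End Generation.

(** * The weight filtration and the powers of the ideal generated by the first layer *)

Section Filtration.
Variables (F : fieldType) (L : lieSuperalgType F).
Hypothesis even0 : forall a b : L, homog false a -> homog false b -> brk a b = 0.
Hypothesis odd0 : forall x y : L, homog true x -> homog true y -> brk x y = 0.
Variables (R : algType F) (j : L -> R).
Hypotheses (jmap : env_map j) (genR : linearly_generates j) (charF0 : [pchar F] =i pred0).

(** Elements of weight at least [r] and parity [i]: even generators have weight 0, and an element of
    layer [k] has weight [k]. *)
Inductive filt : nat -> bool -> R -> Prop :=
| filt0 r i : filt r i 0
| filt_lin r i c p q : filt r i p -> filt r i q -> filt r i (c *: p + q)
| filt1 : filt 0 false 1
| filt_even a : homog false a -> filt 0 false (j a)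
| filt_odd k y : ad_layer k y -> filt k true (j y)
| filtM r s i k p q : filt r i p -> filt s k q -> filt (r + s) (i (+) k) (p * q)
| filt_weaken r i p : filt r.+1 i p -> filt r i p.

Lemma filt_le r s i p : (s <= r)%N -> filt r i p -> filt s i p.
Proof.
move=> sr; rewrite -(subnK sr); elim: (r - s)%N => [//|d IH] fp.
by apply/IH/filt_weaken.
Qed.

Lemma filtM_le t r s i k l p q : filt r i p -> filt s k q ->
  (t <= r + s)%N -> l = i (+) k -> filt t l (p * q).
Proof. by move=> fp fq le ->; apply: filt_le le _; apply: filtM. Qed.

Lemma filtZ r i c p : filt r i p -> filt r i (c *: p).
Proof. by move=> fp; rewrite -[_ *: _]addr0; apply: filt_lin => //; apply: filt0. Qed.

Lemma filtD r i p q : filt r i p -> filt r i q -> filt r i (p + q).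
Proof. by move=> fp fq; rewrite -[p]scale1r; apply: filt_lin. Qed.

Definition super_comm i k p q : R := p * q - (-1) ^+ (i && k) *: (q * p).

Lemma super_comm_linl i k c p p' q :
  super_comm i k (c *: p + p') q = c *: super_comm i k p q + super_comm i k p' q.
Proof.
rewrite /super_comm mulrDl mulrDr -scalerAl -scalerAr scalerDr scalerBr opprD.
by rewrite addrACA !scalerA [c * _]mulrC.
Qed.

Lemma super_comm_linr i k c p q q' :
  super_comm i k p (c *: q + q') = c *: super_comm i k p q + super_comm i k p q'.
Proof.
rewrite /super_comm mulrDl mulrDr -scalerAl -scalerAr scalerDr scalerBr opprD.
by rewrite addrACA !scalerA [c * _]mulrC.
Qed.

Lemma super_commMl i i' k p p' q : super_comm (i (+) i') k (p * p') q =
  p * super_comm i' k p' q + (-1) ^+ (i' && k) *: (super_comm i k p q * p').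
Proof.
rewrite /super_comm mulrBr mulrBl scalerBr -scalerAr -scalerAl scalerA -!mulrA.
rewrite addrA subrK; congr (_ - _ *: _).
by case: i i' k => [] [] [] /=; rewrite ?expr1 ?expr0 ?mulrNN ?mulr1 ?mul1r.
Qed.

Lemma super_commMr i k k' p q q' : super_comm i (k (+) k') p (q * q') =
  super_comm i k p q * q' + (-1) ^+ (i && k) *: (q * super_comm i k' p q').
Proof.
rewrite /super_comm mulrBr mulrBl scalerBr -scalerAr -scalerAl scalerA -!mulrA.
rewrite addrA subrK; congr (_ - _ *: _).
by case: i k k' => [] [] [] /=; rewrite ?expr1 ?expr0 ?mulrNN ?mulr1 ?mul1r.
Qed.

Lemma filt_super_comm_right i r p : filt r i p ->
  (forall a, homog false a -> filt r.+1 i (super_comm i false p (j a))) ->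
  (forall k y, ad_layer k y -> filt (r + k).+1 (~~ i) (super_comm i true p (j y))) ->
  forall s k q, filt s k q -> filt (r + s).+1 (i (+) k) (super_comm i k p q).
Proof.
move=> fp fa fy s k q; elim=> {s k q}.
- by move=> s k; rewrite /super_comm mulr0 mul0r scaler0 subrr; apply: filt0.
- by move=> s k c q q' _ IH _ IH'; rewrite super_comm_linr; apply: filt_lin.
- by rewrite /super_comm mulr1 mul1r andbF scale1r subrr; apply: filt0.
- by move=> a ha; rewrite addn0 addbF; apply: fa.
- by move=> k y ky; rewrite addbT; apply: fy.
- move=> s s' k k' q q' fq IH fq' IH'; rewrite super_commMr; apply: filtD.
    by apply: (filtM_le IH fq'); [lia | rewrite addbA].
  apply: filtZ; apply: (filtM_le fq IH'); first lia.
  by rewrite addbCA.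
- by move=> s k q fq IH; apply: filt_le IH; lia.
Qed.

(** On generators, even with even and odd with odd supercommute, and even with odd lands one layer
    deeper. The product rule, applied in each argument, carries the gain of one to all elements. *)
Lemma filt_super_comm r i p : filt r i p ->
  forall s k q, filt s k q -> filt (r + s).+1 (i (+) k) (super_comm i k p q).
Proof.
have [_ jrel] := jmap.
have zero i0 k0 x y : homog i0 x -> homog k0 y -> brk x y = 0 ->
    super_comm i0 k0 (j x) (j y) = 0.
  move=> hx hy xy; rewrite /super_comm (jrel _ _ _ _ hx hy) xy (env_map0 jmap) addr0.
  by rewrite subrr.
elim=> {r i p}.
- by move=> r i s k q _; rewrite /super_comm mulr0 mul0r scaler0 subrr; apply: filt0.
- move=> r i c p p' _ IH _ IH' s k q fq; rewrite super_comm_linl.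
  by apply: filt_lin; [exact: IH | exact: IH'].
- by move=> s k q _; rewrite /super_comm mulr1 mul1r scale1r subrr; apply: filt0.
- move=> a ha; apply: filt_super_comm_right; first exact: filt_even.
    by move=> b hb; rewrite zero ?even0 //; apply: filt0.
  move=> k y ky; rewrite /super_comm (jrel _ _ _ _ ha (ad_layer_odd ky)) addrAC subrr add0r.
  rewrite brk_even_skew // -scaleN1r (env_mapZ jmap); apply: filtZ.
  by apply: filt_odd; apply: ad_layer_brk.
- move=> k y ky; apply: filt_super_comm_right; first exact: filt_odd.
    move=> a ha; rewrite /super_comm (jrel _ _ _ _ (ad_layer_odd ky) ha) addrAC subrr add0r.
    by apply: filt_odd; apply: ad_layer_brk.
  move=> l z lz; rewrite zero; first exact: filt0.
  - exact: (ad_layer_odd ky).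
  - exact: (ad_layer_odd lz).
  - by apply: odd0; [exact: (ad_layer_odd ky) | exact: (ad_layer_odd lz)].
- move=> r r' i i' p p' fp IH fp' IH' s k q fq; rewrite super_commMl; apply: filtD.
    by apply: (filtM_le fp (IH' _ _ _ fq)); [lia | rewrite addbA].
  apply: filtZ; apply: (filtM_le (IH _ _ _ fq) fp'); first lia.
  by rewrite addbAC.
- by move=> r i p fp IH s k q fq; apply: filt_le (IH _ _ _ fq); lia.
Qed.

Definition filt_any r u : Prop := exists p q, [/\ u = p + q, filt r false p & filt r true q].

Lemma filt_filt_any r i p : filt r i p -> filt_any r p.
Proof.
move=> fp; case: i fp => fp; [exists 0, p | exists p, 0]; rewrite ?add0r ?addr0.
  by split=> //; apply: filt0.
by split=> //; apply: filt0.
Qed.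

Lemma filt_any_lin r c u v : filt_any r u -> filt_any r v -> filt_any r (c *: u + v).
Proof.
move=> [p [q [-> fp fq]]] [p' [q' [-> fp' fq']]].
exists (c *: p + p'), (c *: q + q'); rewrite scalerDr addrACA.
by split=> //; apply: filt_lin.
Qed.

Lemma filt_anyD r u v : filt_any r u -> filt_any r v -> filt_any r (u + v).
Proof. by move=> ru rv; rewrite -[u]scale1r; apply: filt_any_lin. Qed.

Lemma filt_anyZ r c u : filt_any r u -> filt_any r (c *: u).
Proof.
move=> ru; rewrite -[_ *: _]addr0; apply: filt_any_lin => //.
exact: filt_filt_any (filt0 r true).
Qed.

Lemma filt_anyM r s u v : filt_any r u -> filt_any s v -> filt_any (r + s) (u * v).
Proof.
move=> [p [q [-> fp fq]]] [p' [q' [-> fp' fq']]]; rewrite mulrDl !mulrDr.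
apply: filt_anyD; apply: filt_anyD.
- by apply: filt_filt_any (filtM fp fp').
- by apply: filt_filt_any (filtM fp fq').
- by apply: filt_filt_any (filtM fq fp').
- by apply: filt_filt_any (filtM fq fq').
Qed.

Lemma filt_anyT u : filt_any 0 u.
Proof.
apply: (generators_left genR) => [||| x v fv].
- exact: filt_filt_any (filt0 0 true).
- by move=> c p q; apply: filt_any_lin.
- exact: filt_filt_any filt1.
rewrite -[0%N]addn0; apply: filt_anyM fv.
have [x0 [x1 [h0 h1 ->]]] := homog_sum x.
exists (j x0), (j x1); split; first exact: (env_mapD jmap).
  exact: filt_even.
exact: (@filt_odd 0).
Qed.

(** With an even argument the commutator is a supercommutator and gains weight. For odd [q] and [v1]
    it is [2 q v1] minus the supercommutator, and [q v1] is even, so the second commutator gains. *)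
Lemma filt_any_comm r u v w : filt_any r u -> filt_any r.+1 (comm_br (comm_br u v) w).
Proof.
have DL (x y z : R) : comm_br (x + y) z = comm_br x z + comm_br y z.
  by rewrite /comm_br mulrDl mulrDr opprD addrACA.
have DR (x y z : R) : comm_br z (x + y) = comm_br z x + comm_br z y.
  by rewrite /comm_br mulrDl mulrDr opprD addrACA.
have ideal s x y : filt_any s x -> filt_any s (comm_br x y).
  move=> sx; rewrite /comm_br -scaleN1r; apply: filt_anyD.
    by rewrite -[s]addn0; apply: filt_anyM (filt_anyT _).
  by apply: filt_anyZ; rewrite -[s]add0n; apply: filt_anyM (filt_anyT _) _.
have even s x y : filt s false x -> filt_any s.+1 (comm_br x y).
  move=> sx; have [p [q [-> fp fq]]] := filt_anyT y; rewrite DR.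
  apply: filt_anyD; apply: filt_filt_any.
    by have := filt_super_comm sx fp; rewrite /super_comm scale1r addn0; apply.
  by have := filt_super_comm sx fq; rewrite /super_comm scale1r addn0; apply.
move=> [p [q [-> fp fq]]]; rewrite (DL p q v) (DL (comm_br p v)); apply: filt_anyD.
  by apply: ideal; apply: even.
have [v0 [v1 [-> f0 f1]]] := filt_anyT v; rewrite DR DL; apply: filt_anyD.
  apply: ideal; have := filt_super_comm fq f0.
  by rewrite /super_comm scale1r addn0; apply: filt_filt_any.
rewrite (_ : comm_br q v1 = 2%:R *: (q * v1) + (-1) *: super_comm true true q v1).
  have ZL c (x z : R) : comm_br (c *: x) z = c *: comm_br x z.
    by rewrite /comm_br -scalerAl -scalerAr scalerBr.
  rewrite DL !ZL; apply: filt_anyD; apply: filt_anyZ.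
    by apply: even; rewrite -[r]addn0; apply: (filtM fq f1).
  apply: ideal; have := filt_super_comm fq f1; rewrite addn0.
  exact: filt_filt_any.
rewrite /super_comm /comm_br /= expr1 !scaleN1r opprK opprD scaler_nat mulr2n.
by rewrite addrA addrK.
Qed.

Lemma filt_any_foldl N s : size s = N.*2 -> forall u, filt_any N (foldl (@comm_br R) u s).
Proof.
elim: N s => [|N IH] s; first by move=> _ u; apply: filt_anyT.
case/lastP: s => // s w; case/lastP: s => [|s v]; first by rewrite size_rcons.
rewrite !size_rcons doubleS => -[sz] u; rewrite !foldl_rcons.
by apply: filt_any_comm; apply: IH.
Qed.

(** The span of the products [m_1 ... m_t p] with all [m_i] in [M]. For the first layer this is a
    power of the ideal it generates; see [ideal_power_left]. *)
Inductive ideal_power (M : set L) : nat -> R -> Prop :=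
| ideal_power0 p : ideal_power M 0 p
| ideal_power_lin t c p q : ideal_power M t p -> ideal_power M t q ->
    ideal_power M t (c *: p + q)
| ideal_power_zero t : ideal_power M t 0
| ideal_powerS t m p : M m -> ideal_power M t p -> ideal_power M t.+1 (j m * p).

Lemma ideal_powerN M t p : ideal_power M t p -> ideal_power M t (- p).
Proof.
move=> Jp; rewrite -scaleN1r -[_ *: _]addr0.
by apply: ideal_power_lin => //; apply: ideal_power_zero.
Qed.

Lemma ideal_powerD M t p q : ideal_power M t p -> ideal_power M t q ->
  ideal_power M t (p + q).
Proof. by move=> Jp Jq; rewrite -[p]scale1r; apply: ideal_power_lin. Qed.

Lemma ideal_power_pred M t p : ideal_power M t p -> ideal_power M t.-1 p.
Proof.
elim=> {t p} [p|t c p q _ Jp _ Jq|t|t m p Mm Jp Jp'].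
- exact: ideal_power0.
- exact: ideal_power_lin.
- exact: ideal_power_zero.
- case: t Jp Jp' => [|t] Jp Jp'; first exact: ideal_power0.
  exact: ideal_powerS.
Qed.

Lemma ideal_power_le M t t' p : (t' <= t)%N -> ideal_power M t p -> ideal_power M t' p.
Proof.
move=> le; rewrite -(subnK le); elim: (t - t')%N => [//|d IH] Jp.
by apply/IH/(ideal_power_pred Jp).
Qed.

(* Each odd generator spanning [M] can be used only once, since it squares to
   zero and anticommutes with the others. *)
Lemma ideal_power_span_cons M e t p : is_subspace M -> M `<=` homog true ->
  homog true e -> ideal_power [set x | exists c, M (x - c *: e)] t p ->
  exists p1 p2, [/\ p = p1 + j e * p2, ideal_power M t p1 & ideal_power M t.-1 p2].
Proof.
move=> sM oM he; elim=> {t p}.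
- by move=> p; exists p, 0; rewrite mulr0 addr0; split=> //; apply: ideal_power0.
- move=> t c p q _ [p1 [p2 [-> J1 J2]]] _ [q1 [q2 [-> K1 K2]]].
  exists (c *: p1 + q1), (c *: p2 + q2); split; try exact: ideal_power_lin.
  by rewrite scalerDr mulrDr scalerAr addrACA.
- move=> t; exists 0, 0; rewrite mulr0 addr0; split=> //; exact: ideal_power_zero.
move=> t m p [c Mm] _ [p1 [p2 [-> J1 J2]]].
set m' := m - c *: e in Mm; have mE : m = c *: e + m' by rewrite addrC subrK.
exists (j m' * p1), (c *: p1 - j m' * p2); split.
- have e2 : j e * j e = 0.
    by apply: (anticomm_sqr charF0); apply: (env_map_anticomm jmap) => //; apply: odd0.
  have em : j m' * j e = - (j e * j m').
    by apply: (env_map_anticomm jmap) => //; [exact: oM | apply: odd0 => //; exact: oM].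
  rewrite mE (env_map_lin jmap) mulrDl !mulrDr -!scalerAl [j e * (j e * _)]mulrA e2.
  rewrite mul0r scaler0 addr0 [j m' * (j e * _)]mulrA em mulNr -mulrA.
  by rewrite scalerAr mulrN addrCA.
- exact: ideal_powerS.
- apply: ideal_power_lin => //; apply: ideal_powerN.
  case: t J1 J2 => [|t] J1 J2 /=; first exact: ideal_power0.
  exact: ideal_powerS.
Qed.

Lemma ideal_power_mono M M' t p : M `<=` M' -> ideal_power M t p -> ideal_power M' t p.
Proof.
move=> MM; elim=> {t p} [p|t c p q _ Jp _ Jq|t|t m p Mm _ Jp].
- exact: ideal_power0.
- exact: ideal_power_lin.
- exact: ideal_power_zero.
- by apply: ideal_powerS => //; apply: MM.
Qed.

(** As in an exterior algebra, a product of more factors than there are generators vanishes.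
    Splitting off [e] lowers the number of generators by one and the exponent by at most one. *)
Lemma ideal_power_eq0 (es : seq L) t p : (forall e, e \in es -> homog true e) ->
  (size es < t)%N -> ideal_power (mod_span [set 0] es) t p -> p = 0.
Proof.
elim: es t p => [|e es IH] t p hes /=.
  move=> t0 Jp; elim: Jp t0 => {t p} // [t c p q _ IHp _ IHq t0|t m p m0 _ _ _].
    by rewrite IHp // IHq // scaler0 addr0.
  have [c] := mod_spanP (subspace_set0 L) m0; rewrite big_ord0 subr0 => /= ->.
  by rewrite (env_map0 jmap) mul0r.
move=> lt Jp; have he : homog true e by apply: hes; rewrite inE eqxx.
have hes' x : x \in es -> homog true x by move=> ex; apply: hes; rewrite inE ex orbT.
have [||p1 [p2 [-> J1 J2]]] :=
    ideal_power_span_cons (M := mod_span [set 0] es)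
      (mod_span_subspace _ _) _ he (t := t) (p := p).
- apply: mod_span_min => [|x /= ->|//]; first exact: homog_subspace.
  exact: subspace0 (homog_subspace _).
- apply: ideal_power_mono Jp; apply: mod_span_min => [|x x0|x].
  + split; first by exists 0; rewrite scale0r subr0; apply: subspace0 (mod_span_subspace _ _).
    move=> a x y [c Mx] [d My]; exists (a * c + d).
    rewrite (_ : _ - _ = a *: (x - c *: e) + (y - d *: e)).
      by case: (mod_span_subspace [set 0] es) => _; apply.
    by rewrite scalerBr addrACA -opprD scalerDl scalerA.
  + by exists 0; rewrite scale0r subr0; apply: mod_spanW.
  + rewrite inE => /orP[/eqP ->|xes].
      exists 1; rewrite scale1r subrr; exact: subspace0 (mod_span_subspace _ _).
    by exists 0; rewrite scale0r subr0; apply: mod_span_mem.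
rewrite (IH _ _ hes' _ J1) ?(ltnW lt) // (IH _ _ hes' _ J2) ?mulr0 ?addr0 //.
by move: lt; case: (t).
Qed.

Local Notation J := (ideal_power (@ad_layer F L 1)).

(** The odd part of [x] anticommutes with [m]; the even part commutes with it up to a bracket that
    stays in the first layer. *)
Lemma ideal_power_gen x t p : J t p -> J t (j x * p).
Proof.
move=> Jp; elim: Jp x => {t p} [p|t c p q _ IHp _ IHq|t|t m p Mm Jp IH] x.
- exact: ideal_power0.
- by rewrite mulrDr -scalerAr; apply: ideal_power_lin.
- by rewrite mulr0; apply: ideal_power_zero.
have hm : homog true m := ad_layer_odd Mm.
have [x0 [x1 [h0 h1 ->]]] := homog_sum x.
have [_ jrel] := jmap.
rewrite (env_mapD jmap) mulrDl; apply: ideal_powerD; rewrite mulrA.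
  rewrite (jrel _ _ _ _ h0 hm) scale1r mulrDl -mulrA; apply: ideal_powerD.
    exact: ideal_powerS.
  apply: ideal_powerS => //; rewrite brk_even_skew //.
  by apply: (subspaceN (@ad_layer_subspace F L 1)); apply: ad_layerS; apply: ad_layer_brk.
rewrite (jrel _ _ _ _ h1 hm) odd0 // (env_map0 jmap) addr0 scaleN1r mulNr -mulrA.
by apply/ideal_powerN/ideal_powerS.
Qed.

Lemma ideal_power_left u t p : J t p -> J t (u * p).
Proof.
move=> Jp; move: u; apply: (generators_left genR (P := fun u => J t (u * p))) => [|c u v||x u Ju].
- by rewrite mul0r; apply: ideal_power_zero.
- by rewrite mulrDl -scalerAl; apply: ideal_power_lin.
- by rewrite mul1r.
- by rewrite -mulrA; apply: ideal_power_gen.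
Qed.

Lemma ideal_powerM t s p q : J t p -> J s q -> J (t + s) (p * q).
Proof.
move=> Jp Jq; elim: Jp => {t p} [p|t c p p' _ IHp _ IHp'|t|t m p Mm _ IHp].
- exact: ideal_power_left.
- by rewrite mulrDl -scalerAl; apply: ideal_power_lin.
- by rewrite mul0r; apply: ideal_power_zero.
- by rewrite -mulrA addSn; apply: ideal_powerS.
Qed.

(** A nonzero odd generator of positive weight has weight at most [N] and supplies one factor. The
    bound says that [t] is at most [r / (N + 1)] rounded up, which is compatible with products. *)
Lemma filt_ideal_power N r i p : (forall k, (N < k)%N -> @ad_layer F L k `<=` [set 0]) ->
  filt r i p -> forall t, (t * N.+1 < r + N.+1)%N -> J t p.
Proof.
move=> nil; elim=> {r i p}.
- by move=> r i t _; apply: ideal_power_zero.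
- by move=> r i c p q _ IHp _ IHq t lt; apply: ideal_power_lin; [apply: IHp|apply: IHq].
- by move=> [|t] lt; [exact: ideal_power0 | lia].
- by move=> a ha [|t] lt; [exact: ideal_power0 | lia].
- move=> k y ky t lt; have [kN|Nk] := leqP k N; last first.
    by have /= -> := nil _ Nk _ ky; rewrite (env_map0 jmap); apply: ideal_power_zero.
  case: t lt => [|[|t]] lt; [exact: ideal_power0 | | by nia].
  case: k ky kN lt => [|k] ky kN lt; first by lia.
  rewrite -[j y]mulr1; apply: ideal_powerS; last exact: ideal_power0.
  by elim: k ky {kN lt} => // k IH /ad_layerS /IH.
- move=> r s i k p q _ IHp _ IHq t lt.
  (* [t1] is [r / (N + 1)] rounded up, the largest exponent available for [p]; if it exceeds [t],
     the truncated difference [t - t1] is 0. *)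
  pose t1 := ((r + N) %/ N.+1)%N.
  have lo : (t1 * N.+1 <= r + N)%N by apply: leq_divM.
  have hi : (r + N < t1.+1 * N.+1)%N by apply: ltn_ceil.
  apply: (@ideal_power_le _ (t1 + (t - t1))); first lia.
  apply: ideal_powerM; [apply: IHp; lia | apply: IHq].
  by rewrite mulnBl; nia.
- by move=> r i p _ IH t lt; apply: IH; lia.
Qed.

End Filtration.

(** * The equivalence *)

Lemma lie_nilpotent_engel (R : pzRingType) : lie_nilpotent R -> bounded_lie_engel R.
Proof.
(* The Engel index must be positive while [n] may be 0, so one more commutator is taken. *)
move=> [n nil]; exists n.+1 => // x y; rewrite iterS.
have -> : iter n (fun z => comm_br z y) x = foldl (@comm_br R) x (nseq_tuple n y).
  by elim: n {nil} x => // n IH x; rewrite iterSr IH.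
by rewrite nil /comm_br mul0r mulr0 subrr.
Qed.

Lemma comm_scale (F : fieldType) (R : algType F) (c d : F) (x : R) :
  GRing.comm (c *: x) (d *: x).
Proof. by rewrite /GRing.comm -!scalerAl -!scalerAr !scalerA [c * d]mulrC. Qed.

Section Main.
Variables (F : fieldType) (charF0 : [pchar F] =i pred0) (L : lieSuperalgType F).

Lemma set0_eq (W : set L) : is_subspace W -> W `<=` [set 0] -> W = [set 0].
Proof.
by move=> sW W0; apply/seteqP; split=> // x ->; apply: subspace0.
Qed.

Definition structure_condition : Prop :=
  [/\ brk_span (homog false) (homog false) = [set 0 : L],
      nilpotent_super L,
      finite_dim (brk_span [set: L] [set: L]) &
      brk_span (homog true) (homog true) = [set 0 : L] \/
      (dim_le (homog true : set L) 1 /\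
       brk_span (homog false) (homog true) = [set 0 : L])].

Lemma structure_odd_square n (x : L) : engel (env_alg L) n ->
  homog true x -> brk x x <> 0 -> structure_condition.
Proof.
move=> En hx xx; set w := brk x x.
have even0 (a b : L) : homog false a -> homog false b -> brk a b = 0.
  by move=> ha hb; apply: (even_part_abelian charF0 En hb ha).
have mixed (a y : L) : homog false a -> homog true y -> brk a y = 0.
  exact: (even_odd_trivial charF0 En hx xx).
have line (y : L) : homog true y -> exists c, y = c *: x.
  exact: (odd_part_line charF0 En hx xx).
have hw : homog false w by apply: (brk_homog _ _ _ _ hx hx).
have brkw (u v : L) : exists c, brk u v = c *: w.
  have [u0 [u1 [hu0 hu1 ->]]] := homog_sum u.
  have [v0 [v1 [hv0 hv1 ->]]] := homog_sum v.
  rewrite brkDl !brkDr (even0 _ _ hu0 hv0) (mixed _ _ hu0 hv1) !add0r.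
  rewrite -[brk u1 v0]opprK -(brk_even_skew _ hv0) (mixed _ _ hv0 hu1) oppr0 add0r.
  have [c ->] := line _ hu1; have [d ->] := line _ hv1.
  by exists (c * d); rewrite brkZl brkZr scalerA.
have wcentral (v : L) : brk w v = 0.
  have [v0 [v1 [hv0 hv1 ->]]] := homog_sum v.
  by rewrite brkDr even0 // mixed // addr0.
have sw : brk_span [set: L] [set: L] `<=` mod_span [set 0] [:: w].
  apply: lspan_min => [|_ [u _ [v _ <-]]]; first exact: mod_span_subspace.
  have [c ->] := brkw u v; apply: (subspaceZ _ (mod_span_subspace _ _)).
  by apply: mod_span_mem; rewrite inE.
split.
- exact: brk_span_eq0.
(* [lower_central 2] is [((L,L),L)], and [(L,L)] lies on the line of the element [w], whose bracket
   with everything is zero. *)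
- exists 2%N; apply: set0_eq; first exact: lspan_subspace.
  apply: lspan_min => [|_ [u /sw su [v _ <-]]]; first exact: (subspace_set0 L).
  have [c] := mod_spanP (subspace_set0 L) su; rewrite big_ord1 => /= /eqP.
  by rewrite subr_eq0 => /eqP ->; rewrite brkZl wcentral scaler0.
- by apply: finite_dim_mod_span sw; apply: lspan_subspace.
right; split; last exact: brk_span_eq0.
have x0 : x != 0 by apply/eqP => x0; apply: xx; rewrite x0 brk0l.
exists 1%N => //; exists (fun=> x).
  move=> c; rewrite big_ord1 => /eqP; rewrite scaler_eq0 (negbTE x0) orbF => /eqP c0 i.
  by rewrite ord1.
apply/seteqP; split.
  by apply: lspan_min => [|_ [i _ <-]] //; apply: homog_subspace.
move=> y /line[c ->]; apply: (subspaceZ _ (lspan_subspace _)).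
by apply: sub_lspan; exists ord0.
Qed.

Lemma engel_structure n : engel (env_alg L) n -> structure_condition.
Proof.
move=> En.
have [[x [hx xx]]|no] := pselect (exists x : L, homog true x /\ brk x x <> 0).
  exact: structure_odd_square En hx xx.
have even0 (a b : L) : homog false a -> homog false b -> brk a b = 0.
  by move=> ha hb; apply: (even_part_abelian charF0 En hb ha).
have sq0 (x : L) : homog true x -> brk x x = 0.
  move=> hx; have [//|xx] := pselect (brk x x = 0).
  by case: no; exists x.
have odd0 (x y : L) : homog true x -> homog true y -> brk x y = 0.
  move=> hx hy; have hxy : homog true (x + y) by apply: subspaceD => //; apply: homog_subspace.
  (* Polarization of squares: [(x + y, x + y) = 2 (x,y)]. *)
  have := sq0 _ hxy; rewrite brkDl !brkDr !sq0 // add0r addr0 (brk_odd_sym hy hx).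
  exact: (twice_eq0 charF0).
have nil : ad_layer n `<=` [set 0 : L].
  by apply: (ad_layer_nil charF0 even0) => a y ha _; apply: (ad_even_nilpotent charF0 En).
split.
- exact: brk_span_eq0.
- exists n.+1; apply: set0_eq; first exact: lspan_subspace.
  by move=> x /(lower_central_layer even0 odd0) /ad_layerS /nil.
- have [s sP] := layer_finite charF0 even0 odd0 0 En.
  apply: (finite_dim_mod_span (s := s)); first exact: lspan_subspace.
  by move=> x /(lower_central_layer even0 odd0 (k := 0)) /sP.
- by left; apply: brk_span_eq0.
Qed.

Lemma dim_le1_proportional (W : set L) : dim_le W 1 ->
  exists e, forall x, W x -> exists c, x = c *: e.
Proof.
move=> [[|[|//]] _ [e _ <-]].
  by exists 0 => x /lspan_range[c ->]; exists 0; rewrite big_ord0 scaler0.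
by exists (e ord0) => x /lspan_range[c ->]; exists (c ord0); rewrite big_ord1.
Qed.

Lemma structure_lie_nilpotent : structure_condition -> lie_nilpotent (env_alg L).
Proof.
move=> [ab [N nilL] fin alt].
have even0 (a b : L) : homog false a -> homog false b -> brk a b = 0.
  exact: brk_span0 ab.
have jmap := @env_in_map F L; have gen := @env_alg_ind F L.
case: alt => [odd|[dim1 mixed]]; last first.
  have [e eP] := dim_le1_proportional dim1.
  (* Images of even elements commute with all generators, and odd elements are multiples of a single
     [e], so [U(L)] is commutative whether or not [(e,e)] vanishes. *)
  exists 1%N => a [[|b []] //= _].
  apply/eqP; rewrite subr_eq0; apply/eqP.
  apply: (generators_comm gen) => x y.
  have central (a0 y0 : L) : homog false a0 -> GRing.comm (@env_in F L a0) (env_in y0).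
    move=> h0; apply: (env_map_comm jmap) => //.
    rewrite (_ : brk y0 a0 = 0) ?(env_map0 jmap) //.
    rewrite -[LHS]opprK -brk_even_skew //.
    have [z0 [z1 [hz0 hz1 ->]]] := homog_sum y0.
    by rewrite brkDr even0 // (brk_span0 mixed) // addr0 oppr0.
  have [x0 [x1 [h0 /eP[c ->] ->]]] := homog_sum x.
  have [y0 [y1 [k0 /eP[d ->] ->]]] := homog_sum y.
  rewrite (env_mapD jmap x0) (env_mapD jmap y0); apply: commrD; apply/commr_sym.
    by apply: commrD; apply: central.
  apply: commrD; first exact/commr_sym/central.
  rewrite (env_mapZ jmap c) (env_mapZ jmap d); exact: comm_scale.
have odd0 (x y : L) : homog true x -> homog true y -> brk x y = 0.
  exact: brk_span0 odd.
have lc k : ad_layer k `<=` lower_central k.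
  elim: k => [|k IH] //=; apply: lspan_min => [|_ [y ky [a _ <-]]].
    exact: lspan_subspace.
  by apply: brk_spanP => //; apply: IH.
have nil k : (N < k)%N -> ad_layer k `<=` [set 0 : L].
  move=> Nk; rewrite -(subnK (ltnW Nk)); elim: (k - N)%N => [|d IH].
    by rewrite add0n -nilL; apply: lc.
  by rewrite addSn => x /ad_layerS /IH.
have [d [e _ eE]] := fin.
pose es := [seq e i | i <- enum 'I_d].
have layer1 : @ad_layer F L 1 `<=` mod_span [set 0] es.
  apply: (@subset_trans _ (brk_span [set: L] [set: L])).
    by apply: lspan_min => [|_ [y _ [a _ <-]]]; [exact: lspan_subspace | exact: brk_spanP].
  rewrite -eE; apply: lspan_min => [|_ [i _ <-]]; first exact: mod_span_subspace.
  by apply: mod_span_mem; rewrite map_f ?mem_enum.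
have oes x : x \in es -> homog true x.
  move=> /mapP[i _ ->]; apply: (@ad_layer_odd _ _ 1).
  apply: (lower_central_layer even0 odd0 (k := 0)).
  by rewrite /= -/(brk_span _ _) -eE; apply: sub_lspan; exists i.
(* Products of [M] factors from the first layer vanish, weight [T] forces [M] factors, and two
   commutators gain one unit of weight. *)
pose M := (size es).+1; pose T := (M * N.+1)%N.
exists T.*2 => a s.
have [p [q [-> fp fq]]] := filt_any_foldl even0 odd0 jmap gen (N := T) (size_tuple s) a.
have lt : (M * N.+1 < T + N.+1)%N by rewrite /T; lia.
have vanish i r : filt (@env_in F L) T i r -> r = 0.
  move=> fr; apply: (ideal_power_eq0 odd0 jmap charF0 oes (t := M)) => //.
  apply: (ideal_power_mono layer1).
  exact: (filt_ideal_power odd0 jmap gen nil fr lt).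
by rewrite (vanish _ _ fp) (vanish _ _ fq) addr0.
Qed.

End Main.

Theorem corollary1p1 (F : fieldType) (charF0 : [pchar F] =i pred0)
    (L : lieSuperalgType F) :
  (lie_nilpotent (env_alg L) <-> bounded_lie_engel (env_alg L)) /\
  (bounded_lie_engel (env_alg L) <->
   [/\ brk_span (homog false) (homog false) = [set 0 : L],
       nilpotent_super L,
       finite_dim (brk_span [set: L] [set: L]) &
       brk_span (homog true) (homog true) = [set 0 : L] \/
       (dim_le (homog true : set L) 1 /\
        brk_span (homog false) (homog true) = [set 0 : L])]).
Proof.
have fwd : bounded_lie_engel (env_alg L) -> structure_condition L.
  by move=> [n _ En]; exact: (engel_structure charF0 En).
have bwd : structure_condition L -> lie_nilpotent (env_alg L).
  exact: structure_lie_nilpotent.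
have engel1 := @lie_nilpotent_engel (env_alg L).
split; split.
- exact: engel1.
- by move=> /fwd/bwd.
- exact: fwd.
- by move=> /bwd/engel1.
Qed.
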